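(* Let $n\ge1$ and let $Q_1, Q_2\in\mathcal{Q}_n$ have parameters $r_1, r_2, s_1, s_2$, respectively $\tilde{r}_1, \tilde{r}_2, \tilde{s}_1, \tilde{s}_2$. Then $Q_1$ is mutation equivalent to $Q_2$ if and only if $r_1+2r_2=\tilde{r}_1+2\tilde{r}_2$ and $s_1+2s_2=\tilde{s}_1+2\tilde{s}_2$ (or $r_1+2r_2=\tilde{s}_1+2\tilde{s}_2$ and $s_1+2s_2=\tilde{r}_1+2\tilde{r}_2$).
   Context: Quivers and mutation. A quiver is a finite directed graph. Let $Q$ be a quiver without loops and oriented $2$-cycles. The mutation of $Q$ at a vertex $k$ is the quiver $Q^*$ obtained as follows: add a new vertex $k^*$; if there are $r>0$ arrows $i\to k$, $s>0$ arrows $k\to j$ and $t\in\mathbb{Z}$ arrows $j\to i$ in $Q$, then there are $t-rs$ arrows $j\to i$ in $Q^*$ (a negative number of arrows means arrows in the opposite direction); for any vertex $i$ replace all arrows $i\to k$ by arrows $k^*\to i$ and all arrows $k\to i$ by arrows $i\to k^*$; remove $k$. Two quivers are mutation equivalent if one can be obtained (up to isomorphism) from the other by a finite sequence of mutations. A non-oriented cycle of length $m\ge 2$ is a quiver whose underlying graph is a cycle with $m$ vertices and $m$ edges (for $m=2$, a double arrow) and which is not an oriented cycle. Quivers of type $A_k$. Below, a quiver of type $A_k$ means a quiver mutation equivalent to an orientation of the Dynkin diagram $A_k$; equivalently (Buan-Vatne), a connected quiver with $k$ vertices such that all non-trivial cycles in the underlying graph (not passing through the same edge twice) are oriented and of length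 $3$; each vertex has at most four incident arrows; if a vertex has four incident arrows, two of them belong to one oriented $3$-cycle and the other two to another oriented $3$-cycle; if a vertex has three incident arrows, two of them belong to an oriented $3$-cycle and the third does not belong to any oriented $3$-cycle. The class $\mathcal{Q}_n$. It is the class of connected quivers $Q$ with $n+1$ vertices such that: (i) there is precisely one full subquiver which is a non-oriented cycle of length $\ge 2$ (if the length is two, it is a double arrow); (ii) for each arrow $\alpha: x\to y$ of this non-oriented cycle there may (or may not) be a vertex $z_\alpha$ not on the non-oriented cycle such that there is an oriented $3$-cycle $x\xrightarrow{\alpha} y\to z_\alpha\to x$, and apart from the arrows of these oriented $3$-cycles there are no other arrows incident to vertices on the non-oriented cycle; (iii) if all vertices of the non-oriented cycle and their incident arrows are removed, the result is a disjoint union of quivers $Q_\alpha$, one for each $z_\alpha$ (with $z_\alpha$ a vertex of $Q_\alpha$), each $Q_\alpha$ is a quiver of type $A_{k_\alpha}$ for some $k_\alpha\ge1$, the vertex $z_\alpha$ has at most two incident arrows in $Q_\alpha$, and if it has two, then $z_\alpha$ is a vertex of an oriented $3$-cycle in $Q_\alpha$. Convention: if the non-oriented cycle is a double arrow, only one of the two arrows is chosen to be part of the oriented $3$-cycle through a given vertex $z_\alpha$ (different vertices $z$ being attached to different arrows). Parameters. For $Q\in\mathcal{Q}_n$ fix a drawing of $Q$ in the plane without arrow-crossing, so that each arrow of the non-oriented cycle is clockwise or anti-clockwise oriented; this is unique up to reflection of the non-oriented cycle, i.e. up to changing the roles of clockwise and anti-clockwise. Then $r_1$ is the number of arrows that are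 not part of any oriented $3$-cycle and that either lie on the non-oriented cycle and are oriented anti-clockwise, or lie in some $Q_\alpha$ with $\alpha$ an anti-clockwise arrow of the non-oriented cycle. And $r_2$ is the number of oriented $3$-cycles that either share an arrow $\alpha$ with the non-oriented cycle where $\alpha$ is oriented anti-clockwise, or lie in some $Q_\alpha$ with $\alpha$ an anti-clockwise arrow of the non-oriented cycle. The parameters $s_1,s_2$ are defined in the same way with ''clockwise'' instead of ''anti-clockwise''. *)

(* Defs.v *)
From mathcomp Require Import all_boot.

Set Implicit Arguments.
Unset Strict Implicit.
Unset Printing Implicit Defensive.

(* Parallel arrows are recorded by their number: [Q x y] is the number of
   arrows x -> y. *)
Record quiver (V : finType) := Quiver {
  arr :> V -> V -> nat;
  arr_loop : forall x, arr x x = 0;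
  arr_2cycle : forall x y, 0 < arr x y -> arr y x = 0 }.

(* The vertex k* of the mutated quiver is identified with k. Let i, j be
   different from k, with r > 0 arrows i -> k, s > 0 arrows k -> j and
   t = Q j i - Q i j (an integer) arrows j -> i. Then [Q j k * Q k i] = 0, and
   the truncated differences below are the positive part of t - rs (for j -> i)
   and of rs - t (for i -> j). If no path of length 2 through k joins i and j,
   the arrows between i and j are unchanged. *)
Definition mut_arr (V : finType) (Q : quiver V) (k x y : V) : nat :=
  if (x == k) || (y == k) then Q y x
  else (Q x y + Q x k * Q k y) - (Q y x + Q y k * Q k x).

Lemma mut_arr_loop (V : finType) (Q : quiver V) (k x : V) :
  mut_arr Q k x x = 0.
Proof. by rewrite /mut_arr arr_loop subnn if_same. Qed.

Lemma mut_arr_2cycle (V : finType) (Q : quiver V) (k x y : V) :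
  0 < mut_arr Q k x y -> mut_arr Q k y x = 0.
Proof.
rewrite /mut_arr orbC; case: ifP => _; first exact: arr_2cycle.
by rewrite subn_gt0 => /ltnW; rewrite -subn_eq0 => /eqP.
Qed.

Definition mutation (V : finType) (Q : quiver V) (k : V) : quiver V :=
  Quiver (mut_arr_loop Q k) (@mut_arr_2cycle V Q k).

Definition quiver_iso (V W : finType) (Q : quiver V) (Q' : quiver W) : Prop :=
  exists2 f : V -> W, bijective f & forall x y, Q' (f x) (f y) = Q x y.

Definition mutation_equivalent (V W : finType)
    (Q : quiver V) (Q' : quiver W) : Prop :=
  exists ks : seq V, quiver_iso (foldl (@mutation V) Q ks) Q'.

Definition connected_quiver (V : finType) (Q : quiver V) : Prop :=
  forall x y, connect [rel u v | (0 < Q u v) || (0 < Q v u)] x y.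

Definition full_subquiver (V : finType) (Q : quiver V) (A : {set V}) :
    quiver {x : V | x \in A} :=
  @Quiver {x : V | x \in A} (fun x y => Q (val x) (val y))
    (fun x => arr_loop Q (val x)) (fun x y => @arr_2cycle V Q (val x) (val y)).

Definition orientation_of_A (k : nat) (L : quiver 'I_k) : Prop :=
  forall i j : 'I_k,
    L i j + L j i = (j == i.+1 :> nat) + (i == j.+1 :> nat).

Definition type_A (k : nat) (V : finType) (Q : quiver V) : Prop :=
  exists2 L : quiver 'I_k, orientation_of_A L & mutation_equivalent L Q.

(* A closed walk of length m has edges e : 'I_m, the edge e joining positions e
   and e + 1 (mod m). The flag [o e] tells whether the arrow on e points in the
   direction of the walk; [etail] and [ehead] are the positions of its source
   and target. *)
Definition etail (m : nat) (o : 'I_m -> bool) (e : 'I_m) : 'I_m :=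
  if o e then e else ordS e.

Definition ehead (m : nat) (o : 'I_m -> bool) (e : 'I_m) : 'I_m :=
  if o e then ordS e else e.

(* The full subquiver on the vertices c 0, ..., c (m-1) is the non-oriented
   cycle with arrow flags o. For m = 2 the edges 0 and 1 both join c 0 and c 1;
   their flags differ, so that their arrows are parallel: a double arrow. *)
Definition nonoriented_cycle (V : finType) (Q : quiver V)
    (m : nat) (c : 'I_m -> V) (o : 'I_m -> bool) : Prop :=
  [/\ 2 <= m, injective c, (exists e, o e), (exists e, ~~ o e)
    & forall a b, Q (c a) (c b) =
        \sum_(e < m) ((etail o e == a) && (ehead o e == b))].

Definition nonoriented_cycle_on (V : finType) (Q : quiver V)
    (A : {set V}) : Prop :=
  exists m (c : 'I_m -> V) (o : 'I_m -> bool),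
    nonoriented_cycle Q c o /\ A = [set c a | a : 'I_m].

(* Up to isotopy, a drawing of the non-oriented cycle amounts to the choice of
   the sense of rotation called clockwise: [dcyc] lists the vertices of the
   cycle clockwise, so that [dcw e] tells whether the arrow on e is oriented
   clockwise. [datt e] is the vertex z_alpha for the arrow alpha on e, if there
   is one, and [dpart e] is the vertex set of Q_alpha, empty when there is no
   z_alpha. When the cycle is a double arrow, [datt] also records to which of
   the two parallel arrows a vertex is attached. *)
Record drawing (V : finType) := Drawing {
  dlen : nat;
  dcyc : 'I_dlen -> V;
  dcw : 'I_dlen -> bool;
  datt : 'I_dlen -> option V;
  dpart : 'I_dlen -> {set V} }.

Definition on_cycle (V : finType) (D : drawing V) : {set V} :=
  [set dcyc a | a : 'I_(dlen D)].

(* Number of arrows incident to z in the full subquiver on A, for z in A. *)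
Definition valency_in (V : finType) (Q : quiver V) (A : {set V}) (z : V) : nat :=
  \sum_(y in A) (Q z y + Q y z).

(* No two vertices are joined by arrows in both directions, so the vertex set
   of an oriented 3-cycle determines the cycle up to rotation (and up to the
   choice between parallel arrows). *)
Definition oriented_3cycle (V : finType) (Q : quiver V) (S : {set V}) : bool :=
  [exists x, exists y, exists w,
    [&& S == [set x; y; w], 0 < Q x y, 0 < Q y w & 0 < Q w x]].

Definition arrow_in_3cycle (V : finType) (Q : quiver V) (x y : V) : bool :=
  [exists w, (0 < Q y w) && (0 < Q w x)].

Definition attached_3cycles (V : finType) (Q : quiver V) (D : drawing V) : Prop :=
  [/\ forall e z, datt e = Some z ->
        [/\ z \notin on_cycle D,
            Q (dcyc (ehead (@dcw V D) e)) z = 1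
          & Q z (dcyc (etail (@dcw V D) e)) = 1],
      forall a y, y \notin on_cycle D -> 0 < Q (dcyc a) y ->
        exists2 e, datt e = Some y & ehead (@dcw V D) e = a
    & forall a y, y \notin on_cycle D -> 0 < Q y (dcyc a) ->
        exists2 e, datt e = Some y & etail (@dcw V D) e = a].

Definition remainder_decomposition (V : finType) (Q : quiver V)
    (D : drawing V) : Prop :=
  [/\ ~: on_cycle D = \bigcup_(e < dlen D) dpart e,
      forall e f : 'I_(dlen D), e != f -> [disjoint dpart e & dpart f],
      forall (e f : 'I_(dlen D)) x y,
        e != f -> x \in dpart e -> y \in dpart f -> Q x y = 0,
      forall e : 'I_(dlen D), datt e = None -> dpart e = set0
    & forall (e : 'I_(dlen D)) z, datt e = Some z ->
        [/\ z \in dpart e,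
            exists2 k, 1 <= k & type_A k (full_subquiver Q (dpart e)),
            valency_in Q (dpart e) z <= 2
          & valency_in Q (dpart e) z = 2 ->
            exists2 S : {set V},
              oriented_3cycle Q S & (z \in S) && (S \subset dpart e)]].

Definition drawing_of (V : finType) (Q : quiver V) (D : drawing V) : Prop :=
  [/\ nonoriented_cycle Q (@dcyc V D) (@dcw V D),
      attached_3cycles Q D & remainder_decomposition Q D].

Definition class_Q (n : nat) (V : finType) (Q : quiver V) : Prop :=
  [/\ #|V| = n.+1, connected_quiver Q,
      exists! A : {set V}, nonoriented_cycle_on Q A
    & exists D : drawing V, drawing_of Q D].

(* Here [b] selects the clockwise ([true]) or the anti-clockwise ([false])
   arrows of the non-oriented cycle. An arrow alpha of that cycle is part of an
   oriented 3-cycle iff it has a vertex z_alpha; for a double arrow this is the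
   convention that each z belongs to only one of the two arrows. *)
Definition param1 (V : finType) (Q : quiver V) (D : drawing V) (b : bool) : nat :=
  #|[set e : 'I_(dlen D) | (dcw e == b) && (datt e == None)]|
  + \sum_(e < dlen D | dcw e == b)
      \sum_(x in dpart e) \sum_(y in dpart e | ~~ arrow_in_3cycle Q x y) Q x y.

Definition param2 (V : finType) (Q : quiver V) (D : drawing V) (b : bool) : nat :=
  #|[set e : 'I_(dlen D) | (dcw e == b) && (datt e != None)]|
  + \sum_(e < dlen D | dcw e == b)
      #|[set S : {set V} | (S \subset dpart e) && oriented_3cycle Q S]|.

(* A quiver has several drawings, hence parameters defined only up to the
   exchange of (r1, r2) and (s1, s2). *)
Definition has_parameters (V : finType) (Q : quiver V)
    (r1 r2 s1 s2 : nat) : Prop :=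
  exists2 D : drawing V, drawing_of Q D
    & [/\ r1 = param1 Q D false, r2 = param2 Q D false,
          s1 = param1 Q D true & s2 = param2 Q D true].

(* Main.v *)
Require Import Defs.
From mathcomp Require Import all_boot.
From mathcomp Require Import zify.

Set Implicit Arguments.
Unset Strict Implicit.
Unset Printing Implicit Defensive.

(** A quiver in the class is the quiver of a triangulated annulus: the vertices
    on the non-oriented cycle are the arcs joining the two boundary circles, the
    arrows of the cycle are the triangles between consecutive such arcs, and the
    subquiver attached to an arrow is a triangulated polygon, i.e. a binary tree
    rooted at the third side of that triangle. Mutation is the flip of an arc,
    so it preserves the numbers of marked points on the two circles; these are
    the sums of [1 + |Q_alpha|] over the anti-clockwise, resp. clockwise arrows
    alpha, and they equal [r1 + 2 r2] and [s1 + 2 s2], since a quiver of type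
    [A_k] with [a] arrows outside 3-cycles and [c] 3-cycles has
    [k = a + 2 c + 1] vertices.

    If these numbers agree, both quivers mutate to the same cycle: flipping the
    root of a tree moves it onto the cycle, and flipping a source or a sink
    exchanges two consecutive arrows. Conversely the quiver determines the two
    numbers up to exchange: after mutation to a pure cycle with [p] and [q]
    arrows in the two directions, a map from the vertices to [Z/d] that
    increases by one along each arrow exists iff [d] divides [p - q]. *)

(** * Mutation equivalence *)

(** No surface is constructed: a triangulation is a list of triangles with labelled sides, compared
    with the quiver through signed counts of corners. A flip is then an identity between corner
    counts, valid for double arrows too. What makes [Q_alpha] a rooted tree is the condition on
    [z_alpha] in the class: it leaves only boundary edges on one side of [z_alpha], which can thus
    be glued to the annulus. Gradings are used on pure cycles only, because an oriented 3-cycle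
    would force [d] to divide 3. For uniqueness, two annuli of one quiver are carried along the same
    mutations, chosen to bring the first to a pure cycle; the result is acyclic, so the second has
    become a pure cycle as well, and the grading compares the two. The total number of marked points
    is the number of vertices, so the absolute difference, known through its divisors, fixes the
    unordered pair. *)

Lemma mutationK (V : finType) (Q : quiver V) k :
  mutation (mutation Q k) k =2 Q.
Proof.
move=> x y /=; rewrite /mut_arr /= /mut_arr !eqxx /= !orbT.
have [xyk|] := boolP ((x == k) || (y == k)); first by rewrite orbC xyk.
rewrite negb_or => /andP[/negPf-> /negPf->] /=.
have := @arr_2cycle _ Q x y; move: (Q x y) (Q y x) => a b.
rewrite [Q k x * _]mulnC [Q k y * _]mulnC.
by move: (Q x k * Q k y) (Q y k * Q k x) => p q; lia.
Qed.

Lemma quiver_iso_refl (V : finType) (Q Q' : quiver V) :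
  Q =2 Q' -> quiver_iso Q Q'.
Proof. by move=> eQ; exists id => [|x y]; [exists id | rewrite eQ]. Qed.

Lemma quiver_iso_trans (U V W : finType) (Q : quiver U) (Q' : quiver V)
    (Q'' : quiver W) :
  quiver_iso Q Q' -> quiver_iso Q' Q'' -> quiver_iso Q Q''.
Proof.
move=> [f bf ef] [g bg eg]; exists (g \o f); first exact: bij_comp.
by move=> x y /=; rewrite eg ef.
Qed.

Lemma quiver_iso_sym (V W : finType) (Q : quiver V) (Q' : quiver W) :
  quiver_iso Q Q' -> quiver_iso Q' Q.
Proof.
move=> [f [g fK gK] ef]; exists g; first by exists f.
by move=> x y; rewrite -ef !gK.
Qed.

Lemma foldl_mutation_iso (V W : finType) (f : V -> W) (ks : seq V) :
    bijective f -> forall (Q : quiver V) (Q' : quiver W),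
    (forall x y, Q' (f x) (f y) = Q x y) ->
  forall x y, foldl (@mutation W) Q' (map f ks) (f x) (f y) =
              foldl (@mutation V) Q ks x y.
Proof.
move=> bf; have fI := bij_inj bf; elim: ks => [|k ks IH] Q Q' //= eQ.
by apply: IH => x y; rewrite /= /mut_arr !(inj_eq fI) !eQ.
Qed.

Lemma mutation_equivalent_trans (U V W : finType) (Q : quiver U)
    (Q' : quiver V) (Q'' : quiver W) :
  mutation_equivalent Q Q' -> mutation_equivalent Q' Q'' ->
  mutation_equivalent Q Q''.
Proof.
move=> [ks [f bf ef]] [ls isoQ']; have [g fK gK] := bf.
exists (ks ++ map g ls); rewrite foldl_cat.
apply: quiver_iso_trans isoQ'.
exists f => // x y; rewrite -(foldl_mutation_iso (map g ls) bf ef).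
by rewrite -map_comp (eq_map (g := id)) ?map_id.
Qed.

Lemma foldl_mutation_rev (V : finType) (Q : quiver V) ks :
  foldl (@mutation V) (foldl (@mutation V) Q ks) (rev ks) =2 Q.
Proof.
elim: ks Q => [|k ks IH] Q //= x y.
rewrite rev_cons -cats1 foldl_cat /= -[RHS](mutationK Q k) /=.
by rewrite /mut_arr !IH.
Qed.

Lemma mutation_equivalent_sym (V W : finType) (Q : quiver V) (Q' : quiver W) :
  mutation_equivalent Q Q' -> mutation_equivalent Q' Q.
Proof.
move=> [ks /quiver_iso_sym isoQ].
apply: (mutation_equivalent_trans (Q' := foldl (@mutation V) Q ks)).
  by exists [::].
by exists (rev ks); apply: quiver_iso_refl; apply: foldl_mutation_rev.
Qed.

(** * Triangles and flips *)

Section Triangles.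
Variable V : finType.
Implicit Types (x y k : V) (Q : quiver V).

(* The sides of an oriented triangle in cyclic order; [None] is a boundary
   edge. *)
Definition tri := (option V * option V * option V)%type.

Definition ncorner (t : tri) x y : nat :=
  (t.1.1 == Some x) * (t.1.2 == Some y) + (t.1.2 == Some x) * (t.2 == Some y)
  + (t.2 == Some x) * (t.1.1 == Some y).

Definition ncorners (ts : seq tri) x y : nat := \sum_(t <- ts) ncorner t x y.

(* An equality of signed numbers of arrows: opposite arrows cancel. *)
Definition represents Q (ts : seq tri) : Prop :=
  forall x y, Q x y = ncorners ts x y - ncorners ts y x.

Lemma ncorners_cons t ts x y :
  ncorners (t :: ts) x y = ncorner t x y + ncorners ts x y.
Proof. exact: big_cons. Qed.

Lemma ncorners_cat ts ts' x y :
  ncorners (ts ++ ts') x y = ncorners ts x y + ncorners ts' x y.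
Proof. exact: big_cat. Qed.

Lemma ncorners_nil x y : ncorners [::] x y = 0.
Proof. exact: big_nil. Qed.

(* Two boundary edges count as disjoint. *)
Definition disjoint_opt (a b : option V) : bool := (a == None) || (a != b).

Lemma disjoint_optP a b x :
  disjoint_opt a b -> (a == Some x) * (b == Some x) = 0.
Proof. by case: eqP => [->|//] /=; rewrite eq_sym => /negPf->. Qed.

(* [k] is the diagonal of the quadrilateral [a, b, c, d]. *)
Definition flippable k (a b c d : option V) (rest : seq tri) : Prop :=
  [/\ [&& disjoint_opt a b, disjoint_opt a d, disjoint_opt c b
        & disjoint_opt c d],
      Some k \notin [:: a; b; c; d]
    & forall x, ncorners rest k x = 0 /\ ncorners rest x k = 0].

(** Around [k] the arrows are [b, d -> k -> a, c]. The paths of length 2 through [k] cancel the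
    corners [a -> b] and [c -> d] and create [b -> c] and [d -> a], the corners of the two new
    triangles. Sides with the same role may coincide ([a = c] or [b = d]), as happens for double
    arrows; a common out- and in-neighbour is excluded, since its arrows would cancel before the
    mutation. *)
Lemma represents_flip Q k a b c d rest ts ts' :
    flippable k a b c d rest ->
    ncorners ts =2 ncorners [:: (Some k, a, b), (Some k, c, d) & rest] ->
    ncorners ts' =2 ncorners [:: (Some k, b, c), (Some k, d, a) & rest] ->
  represents Q ts -> represents (mutation Q k) ts'.
Proof.
move=> [/and4P[dab dad dcb dcd]]; rewrite !inE !negb_or ![Some k == _]eq_sym.
move=> /and4P[/negPf ak /negPf bk /negPf ck /negPf dk] rk ets ets' repQ.
have sk x : (Some k == Some x :> option V) = (x == k).
  by rewrite (inj_eq (@Some_inj _)) eq_sym.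
move=> x y; rewrite !ets' !ncorners_cons /ncorner /= /mut_arr.
have [|] := boolP ((x == k) || (y == k)); last first.
  rewrite negb_or => /andP[/negPf xk /negPf yk].
  rewrite !repQ !ets !ncorners_cons /ncorner /= !sk xk yk !eqxx ak bk ck dk.
  have [-> ->] := rk x; have [-> ->] := rk y; rewrite /= !mul0n !muln0 !mul1n.
  rewrite !muln1 !addn0 !add0n.
  (* No vertex is both an out- and an in-neighbour of [k]. This leaves four cases for [x] and [y],
     and paths through [k] join them only when their roles differ. *)
  have disj z : ((a == Some z) + (c == Some z) = 0) \/
                ((b == Some z) + (d == Some z) = 0).
    have := disjoint_optP z dab; have := disjoint_optP z dad.
    have := disjoint_optP z dcb; have := disjoint_optP z dcd.
    by do 4!case: (_ == Some z) => //=; auto.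
  have := disj x; have := disj y; clear.
  move: (ncorners rest x y) (ncorners rest y x) => R R'.
  move: (nat_of_bool (a == Some x)) (nat_of_bool (b == Some x))
    (nat_of_bool (c == Some x)) (nat_of_bool (d == Some x)).
  move: (nat_of_bool (a == Some y)) (nat_of_bool (b == Some y))
    (nat_of_bool (c == Some y)) (nat_of_bool (d == Some y)).
  move=> ay by_ cy dy ax bx cx dx.
  case=> /eqP; rewrite addn_eq0 => /andP[/eqP-> /eqP->];
  case=> /eqP; rewrite addn_eq0 => /andP[/eqP-> /eqP->];
  rewrite ?muln0 ?mul0n ?addn0 ?add0n ?subn0 ?sub0n ?muln0 ?mul0n;
  rewrite ?mulnDl ?mulnDr.
  - by clear; lia.
  - by rewrite [by_ * ax]mulnC [dy * cx]mulnC; move: (_ * _) (_ * _) (_ * _) (_ *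
      _); clear; lia.
  - by rewrite [bx * ay]mulnC [dx * cy]mulnC; move: (_ * _) (_ * _) (_ * _) (_ * _);
      clear; lia.
  - by clear; lia.
rewrite repQ !ets !ncorners_cons /ncorner /= !sk.
case/orP => /eqP->; rewrite !eqxx ak bk ck dk.
  have [-> ->] := rk y.
  have [->|_] := eqVneq y k; first by rewrite ak bk ck dk.
  rewrite !mul0n !muln0 !mul1n !muln1 ?addn0 ?add0n.
  by congr (_ - _); apply: addnC.
have [-> ->] := rk x.
have [->|_] := eqVneq x k; first by rewrite ak bk ck dk.
rewrite !mul0n !muln0 !mul1n !muln1 ?addn0 ?add0n.
by congr (_ - _); apply: addnC.
Qed.

Lemma ncorner_rot a b c x y : ncorner (a, b, c) x y = ncorner (b, c, a) x y.
Proof. by rewrite /ncorner /= -addnA addnC. Qed.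

Definition labels (ts : seq tri) : seq (option V) :=
  flatten [seq [:: t.1.1; t.1.2; t.2] | t <- ts].

Lemma labels_cat ts ts' : labels (ts ++ ts') = labels ts ++ labels ts'.
Proof. by rewrite /labels map_cat flatten_cat. Qed.

Lemma ncorners_labels ts x :
  Some x \notin labels ts -> forall y, ncorners ts x y = 0 /\ ncorners ts y x = 0.
Proof.
move=> xts y; elim: ts xts => [|t ts IH]; first by rewrite !ncorners_nil.
rewrite /labels /= !inE !negb_or ![Some x == _]eq_sym.
move=> /and4P[/negPf t1 /negPf t2 /negPf t3 /IH[e1 e2]].
by rewrite !ncorners_cons e1 e2 /ncorner t1 t2 t3 !muln0.
Qed.

Definition flips k (ts ts' : seq tri) : Prop :=
  exists a b c d rest,
    [/\ flippable k a b c d rest,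
        ncorners ts =2 ncorners [:: (Some k, a, b), (Some k, c, d) & rest]
      & ncorners ts' =2 ncorners [:: (Some k, b, c), (Some k, d, a) & rest]].

Lemma represents_flips Q k ts ts' :
  flips k ts ts' -> represents Q ts -> represents (mutation Q k) ts'.
Proof. by move=> [a [b [c [d [rest [fl e e']]]]]]; apply: represents_flip e'. Qed.

Lemma flips_eq k ts0 ts0' ts ts' :
    ncorners ts0 =2 ncorners ts -> ncorners ts0' =2 ncorners ts' ->
  flips k ts ts' -> flips k ts0 ts0'.
Proof.
move=> e0 e0' [a [b [c [d [rest [fl e e']]]]]].
exists a, b, c, d, rest; split=> // x y; first by rewrite e0 e.
by rewrite e0' e'.
Qed.

(** Flips are local: triangles without the side [k] are absorbed into [rest]. *)
Lemma flips_cat k ts0 ts ts' :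
  Some k \notin labels ts0 -> flips k ts ts' -> flips k (ts0 ++ ts) (ts0 ++ ts').
Proof.
move=> /ncorners_labels k0 [a [b [c [d [rest [[D M R] e e']]]]]].
exists a, b, c, d, (ts0 ++ rest); split.
- split=> // x; rewrite !ncorners_cat.
  by have [-> ->] := k0 x; have [-> ->] := R x.
- by move=> x y; rewrite ncorners_cat e !ncorners_cons ncorners_cat; lia.
- by move=> x y; rewrite ncorners_cat e' !ncorners_cons ncorners_cat; lia.
Qed.

Lemma represents_eq Q ts ts' :
  ncorners ts =2 ncorners ts' -> represents Q ts -> represents Q ts'.
Proof. by move=> e rQ x y; rewrite rQ !e. Qed.

End Triangles.

Lemma disjoint_optI (V : finType) (a b : option V) :
  (forall x, a = Some x -> b = Some x -> False) -> disjoint_opt a b.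
Proof.
case: a => [x|] //= abF; rewrite /disjoint_opt /=.
by apply/eqP => /esym /(abF x erefl).
Qed.

(** * Binary trees *)

(** Counting occurrences turns uniqueness and disjointness of labels into linear inequalities, which
    [lia] can solve. *)
Definition mult (T : eqType) (x : T) (s : seq T) : nat := count_mem x s.
Arguments mult : simpl never.

Section Multiplicity.
Variable T : eqType.
Implicit Types (x y : T) (s t : seq T).

Lemma mult_nil x : mult x [::] = 0. Proof. by []. Qed.

Lemma mult_cons x y s : mult x (y :: s) = (y == x) + mult x s.
Proof. by []. Qed.

Lemma mult_cat x s t : mult x (s ++ t) = mult x s + mult x t.
Proof. exact: count_cat. Qed.

Lemma mem_mult x s : (x \in s) = (0 < mult x s).
Proof. by rewrite -has_pred1 has_count. Qed.

Lemma mult_perm_eq s t : (forall x, mult x s = mult x t) -> perm_eq s t.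
Proof. by move=> e; apply/allP => x _; apply/eqP/e. Qed.

Lemma uniq_mult s : uniq s <-> forall x, mult x s <= 1.
Proof.
split=> [us x|]; first by rewrite /mult count_uniq_mem //; case: (_ \in _).
elim: s => //= y s IH ms; rewrite mem_mult IH ?andbT => [|x]; last first.
  by apply: leq_trans (ms x); rewrite mult_cons leq_addl.
by have := ms y; rewrite mult_cons eqxx; case: (mult y s).
Qed.

End Multiplicity.


(* A triangulated polygon with a distinguished side [z]; a leaf is a boundary
   edge. *)
Inductive tree (V : Type) := Leaf | Node (z : V) (l r : tree V).
Arguments Leaf {V}.

Fixpoint nodes (V : Type) (T : tree V) : seq V :=
  if T is Node z l r then z :: nodes l ++ nodes r else [::].

Definition tree_root (V : Type) (T : tree V) : option V :=
  if T is Node z _ _ then Some z else None.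

Lemma nodes_Node (V : Type) (z : V) l r :
  nodes (Node z l r) = z :: nodes l ++ nodes r.
Proof. by []. Qed.

Definition multsE := (nodes_Node, mult_nil, mult_cons, mult_cat).

Fixpoint tree_tris (V : finType) (T : tree V) : seq (tri V) :=
  if T is Node z l r then
    (Some z, tree_root l, tree_root r) :: tree_tris l ++ tree_tris r
  else [::].

Section Trees.
Variable V : finType.
Implicit Types (T L R : tree V) (x y k : V).

Lemma root_mult T x : tree_root T = Some x -> 0 < mult x (nodes T).
Proof. by case: T => //= z l r [->]; rewrite mult_cons eqxx. Qed.

Lemma root_neq T x : mult x (nodes T) = 0 -> tree_root T <> Some x.
Proof. by move=> + /root_mult; lia. Qed.

Lemma tree_labels T x :
  Some x \in labels (tree_tris T) -> 0 < mult x (nodes T).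
Proof.
elim: T => //= z l IHl r IHr.
rewrite /labels /= !inE map_cat flatten_cat mem_cat -/(labels _) -/(labels _).
rewrite mult_cons mult_cat (inj_eq (@Some_inj _)) => /or4P[/eqP->|||].
- by rewrite eqxx.
- by move=> /eqP /esym /root_mult; lia.
- by move=> /eqP /esym /root_mult; lia.
- by case/orP => [/IHl|/IHr]; lia.
Qed.

Lemma tree_labels0 T x : mult x (nodes T) = 0 -> Some x \notin labels (tree_tris T).
Proof. by move=> x0; apply/negP => /tree_labels; rewrite x0. Qed.

Lemma disjoint_root (u : option V) T :
  (forall x, (u == Some x) + mult x (nodes T) <= 1) -> disjoint_opt (tree_root T) u.
Proof.
move=> U; apply: disjoint_optI => x /root_mult xT eu.
by have := U x; rewrite eu eqxx; lia.
Qed.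

Lemma disjoint_roots L R :
  (forall x, mult x (nodes L) + mult x (nodes R) <= 1) ->
  disjoint_opt (tree_root L) (tree_root R).
Proof.
move=> U; apply: disjoint_optI => x /root_mult xL /root_mult xR.
by have := U x; lia.
Qed.

Lemma disjoint_optC (a b : option V) : disjoint_opt a b = disjoint_opt b a.
Proof. by rewrite /disjoint_opt; case: a b => [a|] [b|] //=; rewrite eq_sym. Qed.

Lemma notin_opts x (a b c d : option V) :
  a <> Some x -> b <> Some x -> c <> Some x -> d <> Some x ->
  Some x \notin [:: a; b; c; d].
Proof.
move=> /eqP na /eqP nb /eqP nc /eqP nd.
by rewrite !inE !negb_or ![Some x == _]eq_sym na nb nc nd.
Qed.

(* [u] labels the root side, which may be a boundary edge or an arc. *)
Lemma flip_tree (u : option V) L R k :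
    (forall x, (u == Some x) + mult x (nodes L) + mult x (nodes R) <= 1) ->
    0 < mult k (nodes L) + mult k (nodes R) ->
  exists L' R',
    (forall x, mult x (nodes L') + mult x (nodes R') =
               mult x (nodes L) + mult x (nodes R)) /\
    flips k ((u, tree_root L, tree_root R) :: tree_tris L ++ tree_tris R)
            ((u, tree_root L', tree_root R') :: tree_tris L' ++ tree_tris R').
Proof.
have [n] := ubnP (size (nodes L) + size (nodes R)).
elim: n u L R => // n IH u L R szn U kLR.
have [kL|kL] := posnP (mult k (nodes L)).
  case: R kLR szn U => [|v A B] kLR szn U; first by rewrite kL in kLR.
  have [evk|nvk] := eqVneq v k.
    (* A tree rotation: [k] is a diagonal of the quadrilateral with sides [u], [L], [A], [B] in
       cyclic order, and the other diagonal cuts off [L] and [A]. *)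
    subst v; exists (Node k L A), B; split.
      by move=> x; rewrite !multsE; lia.
    have Uk := U k; rewrite !multsE eqxx in Uk.
    have Ux x : (u == Some x) + mult x (nodes L) + (mult x (nodes A) + mult x (nodes
      B)) <= 1.
      by have := U x; rewrite !multsE; lia.
    exists u, (tree_root L), (tree_root A), (tree_root B),
      (tree_tris L ++ tree_tris A ++ tree_tris B); split.
    - split.
      + rewrite ![disjoint_opt u _]disjoint_optC [disjoint_opt (tree_root A)
          (tree_root L)]disjoint_optC.
        apply/and4P; split; first [apply: disjoint_roots|apply: disjoint_root];
        by move=> x; have := Ux x; lia.
      + by apply: notin_opts; [move=> e; rewrite e eqxx in Uk; lia|..]; apply:
          root_neq; lia.
      + by apply: ncorners_labels; rewrite !labels_cat !mem_cat !negb_or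
          !tree_labels0 //; lia.
    - move=> x y; rewrite /= !(ncorners_cons, ncorners_cat) (ncorner_rot u)
        (ncorner_rot _ _ u).
      by lia.
    - move=> x y; rewrite /= !(ncorners_cons, ncorners_cat) (ncorner_rot u).
      by lia.
  (* The flip takes place beyond the side [v], which now plays the part of [u]. *)
  have [L' [R' [m' fl']]] : exists L' R',
    (forall x, mult x (nodes L') + mult x (nodes R') =
               mult x (nodes A) + mult x (nodes B)) /\
    flips k ((Some v, tree_root A, tree_root B) :: tree_tris A ++ tree_tris B)
            ((Some v, tree_root L', tree_root R') :: tree_tris L' ++ tree_tris R').
    apply: IH; first by move: szn; rewrite /= size_cat; lia.
      move=> x; have := U x; rewrite !multsE (inj_eq (@Some_inj _)).
      by lia.
    by move: kLR; rewrite kL /= !multsE (negPf nvk).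
  exists L, (Node v L' R'); split; first by move=> x; rewrite !multsE m'.
  apply: (flips_eq _ _ (flips_cat (ts0 := (u, tree_root L, Some v) :: tree_tris L) _
    fl')).
  - by move=> x y; rewrite /= !(ncorners_cons, ncorners_cat); lia.
  - by move=> x y; rewrite /= !(ncorners_cons, ncorners_cat); lia.
  have kR : 0 < mult k (nodes (Node v A B)) by lia.
  rewrite /labels /= !inE !negb_or tree_labels0 // (inj_eq (@Some_inj _)).
  rewrite eq_sym [_ == v]eq_sym nvk /= andbT; apply/andP; split; last first.
    by rewrite eq_sym; apply/eqP/root_neq.
  by apply/negP => /eqP e; have := U k; rewrite e eqxx; lia.
case: L kL kLR szn U => [|v A B] kL _ szn U; first by rewrite mult_nil in kL.
have [evk|nvk] := eqVneq v k.
  (* The opposite rotation: the cyclic order is now [u], [A], [B], [R]. *)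
  subst v; exists A, (Node k B R); split.
    by move=> x; rewrite !multsE; lia.
  have Uk := U k; rewrite !multsE eqxx in Uk.
  have Ux x : (u == Some x) + mult x (nodes R) + (mult x (nodes A) + mult x (nodes
    B)) <= 1.
    by have := U x; rewrite !multsE; lia.
  exists (tree_root R), u, (tree_root A), (tree_root B),
    (tree_tris A ++ tree_tris B ++ tree_tris R); split.
  - split.
    + apply/and4P; split; first [apply: disjoint_roots|apply: disjoint_root];
      by move=> x; have := Ux x; lia.
    + apply: notin_opts; [|by move=> e; rewrite e eqxx in Uk; lia|..]; apply:
        root_neq; lia.
    + by apply: ncorners_labels; rewrite !labels_cat !mem_cat !negb_or !tree_labels0
        //; lia.
  - move=> x y; rewrite /= !(ncorners_cons, ncorners_cat) (ncorner_rot u).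
    by lia.
  - move=> x y; rewrite /= !(ncorners_cons, ncorners_cat) (ncorner_rot u)
      (ncorner_rot _ _ u).
    by lia.
have [L' [R' [m' fl']]] : exists L' R',
  (forall x, mult x (nodes L') + mult x (nodes R') =
             mult x (nodes A) + mult x (nodes B)) /\
  flips k ((Some v, tree_root A, tree_root B) :: tree_tris A ++ tree_tris B)
          ((Some v, tree_root L', tree_root R') :: tree_tris L' ++ tree_tris R').
  apply: IH; first by move: szn; rewrite /= size_cat; lia.
    move=> x; have := U x; rewrite !multsE (inj_eq (@Some_inj _)).
    by lia.
  by move: kL; rewrite !multsE (negPf nvk).
exists (Node v L' R'), R; split; first by move=> x; rewrite !multsE m'.
apply: (flips_eq _ _ (flips_cat (ts0 := (u, Some v, tree_root R) :: tree_tris R) _ fl')).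
- by move=> x y; rewrite /= !(ncorners_cons, ncorners_cat); lia.
- by move=> x y; rewrite /= !(ncorners_cons, ncorners_cat); lia.
have kR : mult k (nodes R) = 0 by have := U k; lia.
rewrite /labels /= !inE !negb_or tree_labels0 // (inj_eq (@Some_inj _)).
rewrite [k == v]eq_sym nvk /= andbT; apply/andP; split; last first.
  by rewrite eq_sym; apply/eqP/root_neq.
by apply/negP => /eqP e; have := U k; rewrite -e eqxx; lia.
Qed.
End Trees.

(** * Triangulated annuli *)

(* A triangle of the annulus between an arc and the next one in the given
   sense of rotation, with the tree on its third side; the flag tells whether
   the arrow points to the next arc, i.e. on which boundary circle the third
   side lies. *)
Definition step (V : Type) := (bool * tree V * V)%type.

Section Steps.
Variable V : finType.
Implicit Types (x y k : V) (Q : quiver V) (s : seq (step V)).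

Definition step_tri x (st : step V) : tri V :=
  if st.1.1 then (Some x, Some st.2, tree_root st.1.2)
  else (Some st.2, Some x, tree_root st.1.2).

Fixpoint steps_tris x s : seq (tri V) :=
  if s is st :: s' then
    step_tri x st :: tree_tris st.1.2 ++ steps_tris st.2 s'
  else [::].

Fixpoint steps_nodes s : seq V :=
  if s is st :: s' then st.2 :: nodes st.1.2 ++ steps_nodes s' else [::].

Definition steps_end x s : V := last x [seq st.2 | st <- s].

(* The number of marked points on one boundary circle. *)
Definition weight (b : bool) s : nat :=
  \sum_(st <- s | st.1.1 == b) (size (nodes st.1.2)).+1.

(** The word [s] closes up at [x], which is counted once, as the end of the last step. The two [has]
    conditions put a marked point on each boundary circle; they also force at least two steps. *)
Definition annulus Q x s : Prop :=
  [/\ represents Q (steps_tris x s), forall y, mult y (steps_nodes s) = 1,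
      steps_end x s = x, has (fun st => st.1.1) s & has (fun st => ~~ st.1.1) s].

Lemma steps_tris_cat x s s' :
  steps_tris x (s ++ s') = steps_tris x s ++ steps_tris (steps_end x s) s'.
Proof. by elim: s x => //= st s IH x; rewrite IH catA. Qed.

Lemma steps_nodes_cat s s' : steps_nodes (s ++ s') = steps_nodes s ++ steps_nodes s'.
Proof. by elim: s => //= st s ->; rewrite catA. Qed.

Lemma steps_end_cat x s s' : steps_end x (s ++ s') = steps_end (steps_end x s) s'.
Proof. by rewrite /steps_end map_cat last_cat. Qed.

Lemma weight_cat b s s' : weight b (s ++ s') = weight b s + weight b s'.
Proof. by rewrite /weight big_cat. Qed.

Lemma weight_cons b st s :
  weight b (st :: s) = (st.1.1 == b) * (size (nodes st.1.2)).+1 + weight b s.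
Proof. by rewrite /weight big_cons; case: (_ == b); rewrite ?mul1n. Qed.

(** The choice of the first arc is immaterial, so every flip can be performed at the head of the
    word. *)
Lemma annulus_rot Q x s s' :
  annulus Q x (s ++ s') -> annulus Q (steps_end x s) (s' ++ s).
Proof.
move=> [rQ m e h h']; rewrite steps_end_cat in e; split.
- apply: represents_eq rQ => y z.
  by rewrite !steps_tris_cat !ncorners_cat e addnC.
- by move=> y; rewrite -(m y) !steps_nodes_cat !mult_cat addnC.
- by rewrite steps_end_cat e.
- by rewrite has_cat orbC -has_cat.
- by rewrite has_cat orbC -has_cat.
Qed.

Lemma steps_end_mult x s : steps_end x s = x \/ 0 < mult (steps_end x s) (steps_nodes s).
Proof.
elim: s x => [|st s IH] x; first by left.
right; rewrite /steps_end /= -/(steps_end _ _) !multsE.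
by case: (IH st.2) => [->|]; rewrite ?eqxx; lia.
Qed.

Lemma labels_cons (t : tri V) ts : labels (t :: ts) = [:: t.1.1; t.1.2; t.2] ++ labels ts.
Proof. by []. Qed.

Lemma steps_labels0 x s y :
  y != x -> mult y (steps_nodes s) = 0 -> Some y \notin labels (steps_tris x s).
Proof.
elim: s x => // st s IH x yx; rewrite /= !multsE => my.
rewrite labels_cons labels_cat !mem_cat !negb_or tree_labels0 ?IH; try lia.
  have yr : Some y != tree_root st.1.2 by rewrite eq_sym; apply/eqP/root_neq; lia.
  have ys : y != st.2 by rewrite eq_sym; lia.
  rewrite andbT /step_tri; by case: ifP => _; rewrite /= yr !(inj_eq (@Some_inj _)) yx ys.
by rewrite eq_sym; lia.
Qed.

(** * Flips that change the set of arcs joining the two circles *)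

Section LocalFlips.
Variables (A B : tree V) (x y k : V).
Let m z := mult z (nodes A) + mult z (nodes B).
Hypotheses (xk : x != k) (yk : y != k) (mk : m k = 0) (mx : m x = 0)
  (my : m y = 0) (M : forall z, m z <= 1).

Let flippable_tris (a b c d : option V) :
    [&& disjoint_opt a b, disjoint_opt a d, disjoint_opt c b & disjoint_opt c d] ->
    all (mem [:: Some x; Some y; tree_root A; tree_root B]) [:: a; b; c; d] ->
  flippable k a b c d (tree_tris A ++ tree_tris B).
Proof.
move=> D /allP S; split=> //; last first.
  apply: ncorners_labels.
  by rewrite labels_cat mem_cat negb_or !tree_labels0 //; move: mk; rewrite /m; lia.
apply/negP => /S; rewrite !inE => /or4P[] /eqP.
- by case=> /esym; apply/eqP.
- by case=> /esym; apply/eqP.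
- by move/esym/root_mult; move: mk; rewrite /m; lia.
- by move/esym/root_mult; move: mk; rewrite /m; lia.
Qed.

Let dAB : disjoint_opt (tree_root A) (tree_root B).
Proof. by apply: disjoint_roots. Qed.

Let dBA : disjoint_opt (tree_root B) (tree_root A).
Proof. by rewrite disjoint_optC. Qed.

Let dA z : m z = 0 -> disjoint_opt (tree_root A) (Some z) * disjoint_opt (Some z)
  (tree_root A).
Proof.
move=> mz; suff: disjoint_opt (tree_root A) (Some z).
  by move=> h; split=> //; rewrite disjoint_optC.
by apply: disjoint_optI => w /root_mult + [e]; rewrite -e; move: mz; rewrite /m; lia.
Qed.

Let dB z : m z = 0 -> disjoint_opt (tree_root B) (Some z) * disjoint_opt (Some z)
  (tree_root B).
Proof.
move=> mz; suff: disjoint_opt (tree_root B) (Some z).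
  by move=> h; split=> //; rewrite disjoint_optC.
by apply: disjoint_optI => w /root_mult + [e]; rewrite -e; move: mz; rewrite /m; lia.
Qed.

Let dxy : x != y -> disjoint_opt (Some x) (Some y) * disjoint_opt (Some y) (Some x).
Proof. by rewrite /disjoint_opt !(inj_eq (@Some_inj _)) [y == x]eq_sym => ->. Qed.

Let memE := (dAB, dBA, dA mx, dA my, dB mx, dB my).

(** The other diagonal of the quadrilateral reaches the opposite circle, so [k] becomes an arc of
    the cycle. The cyclic order of the sides is [x], [y], [A], [B] for [o = true] and [y], [x], [A],
    [B] otherwise; hence the subtree next to [x] depends on [o]. *)
Lemma flip_root (o : bool) : x != y ->
  flips k (steps_tris x [:: (o, Node k A B, y)])
    (steps_tris x [:: (o, if o then B else A, k); (o, if o then A else B, y)]).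
Proof.
move=> xy; case: o.
  exists (Some x), (Some y), (tree_root A), (tree_root B), (tree_tris A ++ tree_tris
    B); split.
  - by apply: flippable_tris; rewrite ?memE ?dxy //= !inE !eqxx ?orbT.
  - by move=> z t; rewrite /= /step_tri /= !(ncorners_cons, ncorners_cat,
      ncorners_nil) -(ncorner_rot (Some k)); lia.
  - by move=> z t; rewrite /= /step_tri /= !(ncorners_cons, ncorners_cat,
      ncorners_nil) (ncorner_rot (Some x)); lia.
exists (Some y), (Some x), (tree_root A), (tree_root B), (tree_tris A ++ tree_tris
  B); split.
- by apply: flippable_tris; rewrite ?memE ?dxy //= !inE !eqxx ?orbT.
- by move=> z t; rewrite /= /step_tri /= !(ncorners_cons, ncorners_cat,
    ncorners_nil) -(ncorner_rot (Some k)); lia.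
- by move=> z t; rewrite /= /step_tri /= !(ncorners_cons, ncorners_cat,
    ncorners_nil) (ncorner_rot (Some y)); lia.
Qed.

(** Inverse to [flip_root]: both third sides lie on the same circle, and the flip detaches [k] from
    the other one. *)
Lemma flip_path (o : bool) : x != y ->
  flips k (steps_tris x [:: (o, A, k); (o, B, y)])
    (steps_tris x [:: (o, if o then Node k B A else Node k A B, y)]).
Proof.
move=> xy; case: o.
  exists (tree_root A), (Some x), (Some y), (tree_root B), (tree_tris A ++ tree_tris
    B); split.
  - by apply: flippable_tris; rewrite ?memE ?dxy //= !inE !eqxx ?orbT.
  - by move=> z t; rewrite /= /step_tri /= !(ncorners_cons, ncorners_cat,
      ncorners_nil) (ncorner_rot (Some x)); lia.
  - by move=> z t; rewrite /= /step_tri /= !(ncorners_cons, ncorners_cat,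
      ncorners_nil) -(ncorner_rot (Some k)); lia.
exists (Some x), (tree_root A), (tree_root B), (Some y), (tree_tris A ++ tree_tris
  B); split.
- by apply: flippable_tris; rewrite ?memE ?dxy //= !inE !eqxx ?orbT.
- by move=> z t; rewrite /= /step_tri /= !(ncorners_cons, ncorners_cat,
    ncorners_nil) (ncorner_rot (Some y)); lia.
- by move=> z t; rewrite /= /step_tri /= !(ncorners_cons, ncorners_cat,
    ncorners_nil) -(ncorner_rot (Some k)); lia.
Qed.

(** Here [k] is a source or a sink of the cycle, and its flip joins the two circles again. The case
    [x = y] is included: the two steps may be the whole annulus, and then [x] and [k] are joined by
    a double arrow. *)
Lemma flip_turn (o : bool) :
  flips k (steps_tris x [:: (o, A, k); (~~ o, B, y)])
    (steps_tris x [:: (~~ o, B, k); (o, A, y)]).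
Proof.
case: o.
  exists (tree_root A), (Some x), (tree_root B), (Some y), (tree_tris A ++ tree_tris
    B); split.
  - by apply: flippable_tris; rewrite ?memE ?dxy //= !inE !eqxx ?orbT.
  - by move=> z t; rewrite /= /step_tri /= !(ncorners_cons, ncorners_cat,
      ncorners_nil) (ncorner_rot (Some x)) (ncorner_rot (Some y)); lia.
  - by move=> z t; rewrite /= /step_tri /= !(ncorners_cons, ncorners_cat,
      ncorners_nil); lia.
exists (Some x), (tree_root A), (Some y), (tree_root B), (tree_tris A ++ tree_tris
  B); split.
- by apply: flippable_tris; rewrite ?memE ?dxy //= !inE !eqxx ?orbT.
- by move=> z t; rewrite /= /step_tri /= !(ncorners_cons, ncorners_cat,
    ncorners_nil); lia.
- by move=> z t; rewrite /= /step_tri /= !(ncorners_cons, ncorners_cat,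
    ncorners_nil) (ncorner_rot (Some x)) (ncorner_rot (Some y)); lia.
Qed.

End LocalFlips.

(** As [k] occurs exactly once, and within [s], and is not the arc shared with [r], it labels no
    side in the steps [r], which are therefore carried along unchanged. *)
Lemma annulus_flips Q x s s' r k :
    annulus Q x (s ++ r) ->
    (forall y, mult y (steps_nodes s') = mult y (steps_nodes s)) ->
    steps_end x s' = steps_end x s ->
    has (fun st => st.1.1) s' = has (fun st => st.1.1) s ->
    has (fun st => ~~ st.1.1) s' = has (fun st => ~~ st.1.1) s ->
    0 < mult k (steps_nodes s) -> steps_end x s != k ->
    flips k (steps_tris x s) (steps_tris x s') ->
  annulus (mutation Q k) x (s' ++ r).
Proof.
move=> [rQ m e h h'] m' e' hs hs' ks nk fl; split.
- apply: represents_flips rQ.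
  apply: (flips_eq _ _ (flips_cat (ts0 := steps_tris (steps_end x s) r) _ fl)).
  + by move=> y z; rewrite steps_tris_cat !ncorners_cat addnC.
  + by move=> y z; rewrite steps_tris_cat !ncorners_cat addnC e'.
  apply: steps_labels0; first by rewrite eq_sym.
  by have := m k; rewrite steps_nodes_cat mult_cat; lia.
- by move=> y; rewrite -(m y) !steps_nodes_cat !mult_cat m'.
- by rewrite -[RHS]e !steps_end_cat e'.
- by rewrite has_cat hs -has_cat.
- by rewrite has_cat hs' -has_cat.
Qed.

(** A single step cannot carry both flags, so [x] is reached again only after the first step. By
    uniqueness, [x] then differs from all vertices of that step. *)
Lemma annulus_start Q x st s : annulus Q x (st :: s) -> 0 < mult x (steps_nodes s).
Proof.
move=> [_ _ + h h']; case: s h h' => [|st' s] h h'.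
  by move: h h'; rewrite /= !orbF => ->.
move=> <-; rewrite /steps_end /= -/(steps_end _ _) !multsE.
by case: (steps_end_mult st'.2 s) => [->|]; rewrite ?eqxx; lia.
Qed.

Lemma steps_nodes_split k s : 0 < mult k (steps_nodes s) ->
  exists s1 o T y s2,
    s = s1 ++ (o, T, y) :: s2 /\ (y = k \/ 0 < mult k (nodes T)).
Proof.
elim: s => // -[[o T] y] s IH; rewrite /= !multsE.
have [->|_] := eqVneq y k; first by exists [::], o, T, k, s; split=> //; left.
have [kT|kT] := posnP (mult k (nodes T)); last first.
  by exists [::], o, T, y, s; split=> //; right.
rewrite kT !add0n => /IH[s1 [o' [T' [y' [s2 [-> H]]]]]].
by exists ((o, T, y) :: s1), o', T', y', s2.
Qed.

Lemma annulus_shrink_tree Q x o A B k y s :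
  annulus Q x ((o, Node k A B, y) :: s) ->
  annulus (mutation Q k) x
    [:: (o, if o then B else A, k), (o, if o then A else B, y) & s].
Proof.
move=> an; have x0 := annulus_start an.
have [_ m _ _ _] := an; rewrite /= in m; have mx := m x; have my := m y; have mk := m k.
rewrite !multsE !eqxx in mx my mk.
apply: (annulus_flips (s := [:: (o, Node k A B, y)])
          (s' := [:: (o, if o then B else A, k); (o, if o then A else B, y)]) an).
- by move=> z; case: o {an} m => m; rewrite /= !multsE; lia.
- by [].
- by rewrite /=; case: o {an}.
- by rewrite /=; case: o {an}.
- by rewrite /= !multsE eqxx; lia.
- by rewrite /steps_end /=; lia.
apply: flip_root; rewrite ?[x == k]eq_sym ?[x == y]eq_sym; try lia.
by move=> z; have := m z; rewrite !multsE; lia.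
Qed.

Lemma annulus_turn Q x o A B k y s :
  annulus Q x [:: (o, A, k), (~~ o, B, y) & s] ->
  annulus (mutation Q k) x [:: (~~ o, B, k), (o, A, y) & s].
Proof.
move=> an; have x0 := annulus_start an.
have [_ m e _ _] := an; rewrite /= in m; have mx := m x; have my := m y; have mk := m k.
rewrite /= !multsE ?eqxx in mx my mk x0.
have xy : 0 < (y == x) + mult x (steps_nodes s).
  by have := steps_end_mult y s; rewrite [steps_end y s]e => -[->|]; rewrite ?eqxx
    //; lia.
apply: (annulus_flips (s := [:: (o, A, k); (~~ o, B, y)])
          (s' := [:: (~~ o, B, k); (o, A, y)]) an).
- by move=> z; rewrite /= !multsE; lia.
- by [].
- by rewrite /=; case: (o).
- by rewrite /=; case: (o).
- by rewrite /= !multsE eqxx; lia.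
- by rewrite /steps_end /=; lia.
apply: flip_turn; rewrite ?[x == k]eq_sym; try lia.
by move=> z; have := m z; rewrite !multsE; lia.
Qed.

Lemma annulus_straight Q x o A B k y s :
  annulus Q x [:: (o, A, k), (o, B, y) & s] ->
  annulus (mutation Q k) x ((o, if o then Node k B A else Node k A B, y) :: s).
Proof.
move=> an; have x0 := annulus_start an.
have [_ m e h h'] := an; rewrite /= in m; have mx := m x; have my := m y; have mk := m k.
rewrite /= !multsE ?eqxx in mx my mk x0.
(* Two steps with the same flag are not the whole word, so [x] is reached within [s]; this gives
   [x != y]. *)
have xs : 0 < mult x (steps_nodes s).
  case: s e h h' {an m mx my mk x0} => [|st' s] e h h'.
    by move: h h'; rewrite /= !orbF !orbb => ->.
  rewrite -e /steps_end /= -/(steps_end _ _) !multsE.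
  by case: (steps_end_mult st'.2 s) => [->|]; rewrite ?eqxx; lia.
apply: (annulus_flips (s := [:: (o, A, k); (o, B, y)])
          (s' := [:: (o, if o then Node k B A else Node k A B, y)]) an).
- by move=> z; move: m; case: (o) => m; rewrite /= !multsE; lia.
- by [].
- by rewrite /=; case: (o).
- by rewrite /=; case: (o).
- by rewrite /= !multsE eqxx; lia.
- by rewrite /steps_end /=; lia.
apply: flip_path; rewrite ?[x == k]eq_sym ?[x == y]eq_sym; try lia.
by move=> z; have := m z; rewrite !multsE; lia.
Qed.

Lemma annulus_flip_tree Q x o v A B y k s :
    annulus Q x ((o, Node v A B, y) :: s) ->
    0 < mult k (nodes A) + mult k (nodes B) ->
  exists T, size (nodes T) = size (nodes (Node v A B)) /\
    annulus (mutation Q k) x ((o, T, y) :: s).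
Proof.
move=> an kAB; have x0 := annulus_start an.
have [_ m _ _ _] := an; rewrite /= in m; have mx := m x; have my := m y; have mk := m k.
rewrite !multsE ?eqxx in mx my mk.
(* The root [v] is the fixed side of the polygon in which the flip takes place; the triangle of the
   step is only carried along. *)
have [|//|A' [B' [m' fl]]] := @flip_tree _ (Some v) A B k.
  by move=> z; have := m z; rewrite !multsE (inj_eq (@Some_inj _)); lia.
exists (Node v A' B'); split.
  by apply: perm_size; apply: mult_perm_eq => z; rewrite !multsE m'.
apply: (annulus_flips (s := [:: (o, Node v A B, y)])
          (s' := [:: (o, Node v A' B', y)]) an) => //.
- by move=> z; rewrite /= !multsE m'.
- by rewrite /= !multsE; lia.
- by rewrite /steps_end /=; lia.
rewrite /= !cats0.
apply: (flips_cat (ts0 := [:: step_tri x (o, Node v A B, y)]) _ fl).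
have [xk yk vk] : [/\ k != x, k != y & k != v].
  by split; apply/eqP => e; move: kAB; rewrite e; [| |have := m v]; rewrite ?multsE
    ?eqxx; lia.
by rewrite /step_tri; case: (o); rewrite /= !inE !(inj_eq (@Some_inj _)) (negPf xk)
  (negPf yk) (negPf vk).
Qed.

(** Four positions of [k]: on the cycle between equal flags, on the cycle between opposite flags,
    root of a tree, deeper in a tree. A tree with [j] nodes has [j.+1] leaves, which are boundary
    edges of one circle, and each flip keeps the leaves of each circle. *)
Lemma annulus_mutation Q x s k : annulus Q x s ->
  exists x' s', annulus (mutation Q k) x' s' /\ forall b, weight b s' = weight b s.
Proof.
move=> an; have [s1 [o [T [y [s2 [es H]]]]]] : exists s1 o T y s2,
    s = s1 ++ (o, T, y) :: s2 /\ (y = k \/ 0 < mult k (nodes T)).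
  by apply: steps_nodes_split; have [_ -> _ _ _] := an.
rewrite es in an; have {an} an := annulus_rot an.
move: (steps_end x s1) an => x' /=; rewrite es.
have wE b st : weight b (s1 ++ st :: s2) = weight b (st :: s2 ++ s1).
  by rewrite weight_cat !weight_cons weight_cat; lia.
case: H => [->|kT] an.
  case e12: (s2 ++ s1) an => [|[[o2 B] z] r] an.
    by have := annulus_start an.
  have [eo|no] := eqVneq o2 o.
    subst o2; exists x'; eexists; split; first exact: annulus_straight an.
    by move=> b; rewrite wE e12 !weight_cons /=; case: (o); rewrite /= size_cat; lia.
  have eo2 : o2 = ~~ o by case: o o2 no {an e12 es} => -[].
  subst o2; exists x'; eexists; split; first exact: annulus_turn an.
  by move=> b; rewrite wE e12 !weight_cons /=; lia.
case: T kT an es => [|v A B] // kT an es.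
have [evk|nvk] := eqVneq v k.
  subst v; exists x'; eexists; split; first exact: annulus_shrink_tree an.
  by move=> b; rewrite wE !weight_cons /=; case: (o); rewrite size_cat; lia.
have kAB : 0 < mult k (nodes A) + mult k (nodes B).
  by move: kT; rewrite !multsE (negPf nvk).
have [T' [sz an']] := annulus_flip_tree an kAB.
exists x', ((o, T', y) :: s2 ++ s1); split=> // b.
by rewrite wE !weight_cons sz.
Qed.

Lemma annulus_foldl_mutation Q x s ks : annulus Q x s ->
  exists x' s', annulus (foldl (@mutation V) Q ks) x' s' /\
    forall b, weight b s' = weight b s.
Proof.
elim: ks Q x s => [|k ks IH] Q x s an; first by exists x, s.
have [x' [s' [an' w']]] := annulus_mutation k an.
have [x'' [s'' [an'' w'']]] := IH _ _ _ an'.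
by exists x'', s''; split=> // b; rewrite w'' w'.
Qed.

End Steps.

(** * Normal form *)

Section Transport.
Variables (V W : finType) (f : V -> W).
Hypothesis fI : injective f.

Definition tri_map (t : tri V) : tri W :=
  (omap f t.1.1, omap f t.1.2, omap f t.2).

Fixpoint tree_map (T : tree V) : tree W :=
  if T is Node z l r then Node (f z) (tree_map l) (tree_map r) else Leaf.

Definition step_map (st : step V) : step W := (st.1.1, tree_map st.1.2, f st.2).

Lemma omap_eqE (a : option V) x : (omap f a == Some (f x)) = (a == Some x).
Proof. by case: a => //= a; rewrite !(inj_eq (@Some_inj _)) (inj_eq fI). Qed.

Lemma ncorners_map ts x y :
  ncorners [seq tri_map t | t <- ts] (f x) (f y) = ncorners ts x y.
Proof. by rewrite /ncorners big_map; apply: eq_bigr => t _; rewrite /ncorner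
  !omap_eqE. Qed.

Lemma nodes_map T : nodes (tree_map T) = map f (nodes T).
Proof. by elim: T => //= z l -> r ->; rewrite map_cat. Qed.

Lemma tree_root_map T : tree_root (tree_map T) = omap f (tree_root T).
Proof. by case: T. Qed.

Lemma tree_tris_map T : tree_tris (tree_map T) = [seq tri_map t | t <- tree_tris T].
Proof. by elim: T => //= z l -> r ->; rewrite map_cat !tree_root_map. Qed.

Lemma mult_map x s : mult (f x) (map f s) = mult x s.
Proof. by rewrite /mult count_map; apply: eq_count => y /=; rewrite (inj_eq fI). Qed.

Lemma steps_tris_map x s :
  steps_tris (f x) (map step_map s) = [seq tri_map t | t <- steps_tris x s].
Proof.
elim: s x => //= -[[o T] y] s IH x; rewrite map_cat tree_tris_map -IH /step_tri /=.
by rewrite tree_root_map; case: o.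
Qed.

Lemma steps_nodes_map s : steps_nodes (map step_map s) = map f (steps_nodes s).
Proof. by elim: s => //= st s ->; rewrite map_cat nodes_map. Qed.

Lemma steps_end_map x s : steps_end (f x) (map step_map s) = f (steps_end x s).
Proof. by elim: s x => //= st s IH x; apply: IH. Qed.

Lemma weight_map b s : weight b (map step_map s) = weight b s.
Proof.
rewrite /weight big_map; apply: eq_bigr => st _.
by rewrite /= nodes_map size_map.
Qed.

Lemma annulus_iso (Q : quiver V) (Q' : quiver W) x s :
    bijective f -> (forall y z, Q' (f y) (f z) = Q y z) ->
  annulus Q x s -> annulus Q' (f x) (map step_map s).
Proof.
move=> [g fK gK] eQ [rQ m e h h']; split.
- by move=> y z; rewrite -[y]gK -[z]gK eQ rQ steps_tris_map !ncorners_map.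
- by move=> y; rewrite -[y]gK steps_nodes_map mult_map.
- by rewrite steps_end_map e.
- by rewrite has_map.
- by rewrite has_map.
Qed.

End Transport.

(** * Reversal of the sense of rotation *)

Section Reflection.
Variable V : finType.
Implicit Types (x y : V) (Q : quiver V) (s : seq (step V)).

(** The same triangles and trees, read backwards: an arrow towards the next arc now points to the
    previous one. The two weights are exchanged, which accounts for the second alternative of the
    theorem. *)
Fixpoint steps_rev x s : seq (step V) :=
  if s is st :: s' then rcons (steps_rev st.2 s') (~~ st.1.1, st.1.2, x) else [::].

Lemma steps_end_rev x s : steps_end (steps_end x s) (steps_rev x s) = x.
Proof.
by case: s => //= st s; rewrite -cats1 steps_end_cat.
Qed.

Lemma ncorners_steps_rev x s :
  ncorners (steps_tris (steps_end x s) (steps_rev x s)) =2 ncorners (steps_tris x s).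
Proof.
elim: s x => //= -[[o T] y] s IH x z t.
rewrite -cats1 steps_tris_cat (steps_end_rev y s) ncorners_cat IH.
rewrite /= !(ncorners_cons, ncorners_cat, ncorners_nil) /step_tri /=.
by case: o => /=; lia.
Qed.

Lemma steps_nodes_rev x s z :
  mult z (steps_nodes (steps_rev x s)) + (steps_end x s == z)
  = (x == z) + mult z (steps_nodes s).
Proof.
elim: s x => [|[[o T] y] s IH] x /=; first by rewrite mult_nil addn0.
have := IH y; rewrite -cats1 steps_nodes_cat /= !multsE.
by rewrite /steps_end /=; lia.
Qed.

Lemma has_steps_rev (p : bool -> bool) x s :
  has (fun st => p st.1.1) (steps_rev x s) = has (fun st => p (~~ st.1.1)) s.
Proof. by elim: s x => //= st s IH x; rewrite has_rcons IH. Qed.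

Lemma weight_steps_rev b x s : weight b (steps_rev x s) = weight (~~ b) s.
Proof.
elim: s x => //= [|st s IH] x; first by rewrite /weight !big_nil.
rewrite -cats1 weight_cat IH !weight_cons /weight big_nil /=.
by case: (st.1.1) b {IH} => -[]; rewrite /= addn0 addnC.
Qed.

Lemma annulus_rev Q x s : annulus Q x s -> annulus Q x (steps_rev x s).
Proof.
move=> [rQ m e h h']; split.
- by rewrite -{1}e; apply: represents_eq rQ => y z; rewrite ncorners_steps_rev.
- by move=> y; have := steps_nodes_rev x s y; rewrite e m; lia.
- by rewrite -{1}e steps_end_rev.
- by rewrite (has_steps_rev id).
- rewrite (has_steps_rev negb) -(eq_has (a1 := fun st => st.1.1)) // => st.
  by rewrite negbK.
Qed.

End Reflection.

(** * Reduction to a pure cycle with sorted arrows *)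

Section NormalForm.
Variable V : finType.
Implicit Types (x y k : V) (Q : quiver V) (s : seq (step V)) (ps : seq (bool * V)).

Definition bare ps : seq (step V) := [seq (p.1, Leaf, p.2) | p <- ps].

Definition treesize s : nat := \sum_(st <- s) size (nodes st.1.2).

Lemma treesize_split s :
  (exists ps, s = bare ps) \/
  exists s1 o k A B y s2, s = s1 ++ (o, Node k A B, y) :: s2.
Proof.
elim: s => [|[[o T] y] s IH]; first by left; exists [::].
case: T => [|k A B]; last by right; exists [::], o, k, A, B, y, s.
case: IH => [[ps ->]|[s1 [o' [k [A [B [y' [s2 ->]]]]]]]].
  by left; exists ((o, y) :: ps).
by right; exists ((o, Leaf, y) :: s1), o', k, A, B, y', s2.
Qed.

(** Flipping the root of a tree puts it on the cycle and lowers [treesize] by one, whatever its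
    subtrees are. *)
Lemma annulus_bare Q x s : annulus Q x s ->
  exists ks x' ps, annulus (foldl (@mutation V) Q ks) x' (bare ps) /\
    forall b, weight b (bare ps) = weight b s.
Proof.
have [n] := ubnP (treesize s); elim: n Q x s => // n IH Q x s sn an.
have [[ps es]|[s1 [o [k [A [B [y [s2 es]]]]]]]] := treesize_split s.
  by exists [::], x, ps; rewrite -es.
rewrite es in an; have /annulus_shrink_tree/IH[|ks [x' [ps [an' w]]]] := annulus_rot an.
  move: sn; rewrite es /treesize /= !(big_cat, big_cons) /= size_cat.
  by case: (o); lia.
exists (k :: ks), x', ps; split=> // b; rewrite w es !(weight_cat, weight_cons) /=.
by rewrite size_cat; case: (o); lia.
Qed.

Lemma annulus_turn_at Q x s1 o A B k y s2 :
  annulus Q x (s1 ++ [:: (o, A, k), (~~ o, B, y) & s2]) ->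
  annulus (mutation Q k) x (s1 ++ [:: (~~ o, B, k), (o, A, y) & s2]).
Proof.
move=> an; have [_ _ e _ _] := an.
have /annulus_turn an' := annulus_rot an.
have := @annulus_rot _ _ _ [:: (~~ o, B, k), (o, A, y) & s2] s1 an'.
suff -> : steps_end (steps_end x s1) [:: (~~ o, B, k), (o, A, y) & s2] = x by [].
by rewrite -[RHS]e steps_end_cat.
Qed.

(** The termination measure of a bubble sort that moves [true] to the front. *)
Fixpoint inversions (f : seq bool) : nat :=
  if f is b :: f' then (~~ b) * count id f' + inversions f' else 0.

Lemma inversions_swap f1 f2 :
  inversions (f1 ++ [:: false, true & f2]) =
  (inversions (f1 ++ [:: true, false & f2])).+1.
Proof. by elim: f1 => [|b f1 IH] /=; rewrite ?IH ?count_cat /=; lia. Qed.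

Lemma descent_or_sorted ps :
  (exists p1 k y p2, ps = p1 ++ [:: (false, k), (true, y) & p2]) \/
  exists p q, [seq p.1 | p <- ps] = nseq p true ++ nseq q false.
Proof.
elim: ps => [|[b v] ps IH]; first by right; exists 0, 0.
case: IH => [[p1 [k [y [p2 ->]]]]|[p [q e]]].
  by left; exists ((b, v) :: p1), k, y, p2.
case: b; first by right; exists p.+1, q; rewrite /= e.
case: p e => [|p] e; first by right; exists 0, q.+1; rewrite /= e.
case: ps e => // -[b y] ps [-> _]; by left; exists [::], v, y, ps.
Qed.

(** A [false] followed by a [true] meets at a source, and its flip transposes the two flags. On a
    pure cycle each step weighs 1, so the sorted word is determined by the weights. *)
Lemma annulus_sorted Q x s : annulus Q x s ->
  exists ks x' ps, [/\ annulus (foldl (@mutation V) Q ks) x' (bare ps),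
    forall b, weight b (bare ps) = weight b s
    & [seq p.1 | p <- ps] = nseq (weight true s) true ++ nseq (weight false s) false].
Proof.
move=> /annulus_bare[ks [x' [ps [an w]]]].
suff [ls [ps' [an' w' [p [q e]]]]] : exists ls ps',
    [/\ annulus (foldl (@mutation V) (foldl (@mutation V) Q ks) ls) x' (bare ps'),
      forall b, weight b (bare ps') = weight b (bare ps)
      & exists p q, [seq p.1 | p <- ps'] = nseq p true ++ nseq q false].
  exists (ks ++ ls), x', ps'; split; first by rewrite foldl_cat.
    by move=> b; rewrite w' w.
  have wE b : weight b s = count (pred1 b) [seq p.1 | p <- ps'].
    rewrite -w -w' /weight /bare big_map count_map -sum1_count.
    by rewrite big_mkcond [RHS]big_mkcond; apply: eq_bigr.
  by rewrite !wE e !count_cat !count_nseq /= !mul1n !mul0n addn0 add0n.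
move: (foldl _ Q ks) an => {w}Q' an.
have [n] := ubnP (inversions [seq p.1 | p <- ps]).
elim: n Q' ps an => // n IH Q' ps an szn.
have [[p1 [k [y [p2 eps]]]]|H] := descent_or_sorted ps; last first.
  by exists [::], ps.
subst ps; move: an; rewrite /bare map_cat /= -/(bare _).
move=> /(annulus_turn_at (o := false)) an.
have [||ls [ps' [an' w' H]]] :=
    IH (mutation Q' k) (p1 ++ [:: (true, k), (false, y) & p2]).
- by rewrite /bare map_cat.
- by move: szn; rewrite !map_cat /= inversions_swap.
exists (k :: ls), ps'; split=> // b.
by rewrite w' /bare !map_cat !weight_cat /= !weight_cons /=; lia.
Qed.

End NormalForm.

Lemma bare_iso (V W : finType) (Q : quiver V) (Q' : quiver W) x y ps ps' :
    annulus Q x (bare ps) -> annulus Q' y (bare ps') ->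
    [seq p.1 | p <- ps] = [seq p.1 | p <- ps'] ->
  quiver_iso Q Q'.
Proof.
have bare_nodes (U : finType) (rs : seq (bool * U)) : steps_nodes (bare rs) = [seq
  r.2 | r <- rs].
  by elim: rs => //= r rs ->.
have bare_end (U : finType) z (rs : seq (bool * U)) : steps_end z (bare rs) = last z
  [seq r.2 | r <- rs].
  by rewrite /steps_end /bare -map_comp.
move=> [rQ m e h _] [rQ' m' e' _ _] ef.
have sz : size ps = size ps' by rewrite -(size_map fst) ef size_map.
set vs := [seq p.2 | p <- ps]; set vs' := [seq p.2 | p <- ps'].
have szv : size vs = size vs' by rewrite !size_map.
have us : uniq vs by apply/uniq_mult => z; rewrite /vs -bare_nodes m.
have us' : uniq vs' by apply/uniq_mult => z; rewrite /vs' -bare_nodes m'.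
have al z : z \in vs by rewrite mem_mult /vs -bare_nodes m.
have al' z : z \in vs' by rewrite mem_mult /vs' -bare_nodes m'.
(* Vertices are matched by their position along the two cycles; the defaults are never reached. *)
pose f z := nth y vs' (index z vs); pose g z := nth x vs (index z vs').
have fK : cancel f g.
  by move=> z; rewrite /f /g index_uniq // ?nth_index // -szv index_mem.
have gK : cancel g f.
  by move=> z; rewrite /f /g index_uniq // ?nth_index // szv index_mem.
have fvs : map f vs = vs'.
  apply: (@eq_from_nth _ y); rewrite size_map ?szv // -szv => i ilt.
  by rewrite (nth_map x) // /f index_uniq.
have fps : map (step_map f) (bare ps) = bare ps'.
  apply: (@eq_from_nth _ (true, Leaf, y)); rewrite ?size_map // => i ilt.
  have ilt' : i < size ps' by rewrite -sz.
  rewrite (nth_map (true, Leaf, x)) ?size_map // !(nth_map (true, x)) //.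
  rewrite (nth_map (true, y)) // /step_map /=; congr (_, _, _).
    by rewrite -!(nth_map _ true) // ef.
  rewrite -(nth_map _ x snd) // -(nth_map _ y snd) // -/vs -/vs' -fvs.
  by rewrite (nth_map x) ?size_map.
(* The base arc is the last vertex of the list, since the word closes up. *)
have fx : f x = y.
  have lastE z w t : 0 < size t -> f (last z t) = last w (map f t).
    by case: t => // a t _; rewrite /= last_map.
  by rewrite -e -e' !bare_end -/vs -/vs' -fvs (lastE x y) // size_map; case: (ps) h.
exists f; first by exists g.
by move=> z t; rewrite rQ' rQ -fps -fx steps_tris_map !ncorners_map //; apply: can_inj fK.
Qed.

Lemma annulus_equivalent (V W : finType) (Q : quiver V) (Q' : quiver W) x y s s' :
    annulus Q x s -> annulus Q' y s' ->
    (forall b, weight b s = weight b s') ->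
  mutation_equivalent Q Q'.
Proof.
move=> /annulus_sorted[ks [x' [ps [an _ e]]]] /annulus_sorted[ls [y' [ps' [an' _ e']]]] w.
apply: (mutation_equivalent_trans (Q' := foldl (@mutation W) Q' ls)).
  by exists ks; apply: bare_iso an an' _; rewrite e e' !w.
by apply: mutation_equivalent_sym; exists ls; apply: quiver_iso_refl.
Qed.

(** * Uniqueness of the pair of weights *)

Section Uniqueness.
Variable V : finType.
Implicit Types (x y z u v : V) (Q : quiver V) (s : seq (step V)) (ps : seq (bool * V)).

Lemma ncorners0 ts u v :
  (Some u \notin labels ts) || (Some v \notin labels ts) -> ncorners ts u v = 0.
Proof.
by case/orP => /ncorners_labels => [/(_ v)|/(_ u)] [].
Qed.

(** The corner between [x] and [y] is not cancelled: another triangle contains both arcs only if the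
    word has two steps, and then its flag is opposite and its arrow, read backwards, is parallel to
    the first. *)
Lemma annulus_edge Q x o T y s : annulus Q x ((o, T, y) :: s) ->
  if o then 0 < Q x y else 0 < Q y x.
Proof.
move=> an; have x0 := annulus_start an.
have [rQ m e h h'] := an; rewrite /= in m; have mx := m x; have my := m y.
rewrite !multsE eqxx in mx my.
have yx : (y == x) = false by lia.
have xT : (tree_root T == Some x) = false by apply/eqP/root_neq; lia.
have yT : (tree_root T == Some y) = false by apply/eqP/root_neq; lia.
have Txy : ncorners (tree_tris T) x y = 0.
  by apply: ncorners0; rewrite tree_labels0 //; lia.
have Tyx : ncorners (tree_tris T) y x = 0.
  by apply: ncorners0; rewrite tree_labels0 //; lia.
suff sE : if o then ncorners (steps_tris y s) y x = 0 else ncorners (steps_tris y s)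
  x y = 0.
  case: o sE {an e h h'} rQ => sE rQ; rewrite rQ /= !(ncorners_cons, ncorners_cat)
    Txy Tyx sE;
  by rewrite /ncorner /step_tri /= !(inj_eq (@Some_inj _)) !eqxx [x == y]eq_sym yx xT yT.
case: s x0 e h h' an rQ m mx my => [//|[[o' T'] w] s] x0 e h h' an rQ m mx my.
rewrite /= !multsE in x0 mx my *.
have T'0 u v : (u == y) || (v == y) -> ncorners (tree_tris T') u v = 0.
  move=> H; apply: ncorners0; case/orP: H => /eqP->; rewrite [Some y \notin
    _]tree_labels0 ?orbT //; clear -my; lia.
have xT' : (tree_root T' == Some x) = false.
  apply/eqP/root_neq; case: s e x0 mx {an rQ my h h' m} => [|st s] e x0 mx.
    by move: e mx; rewrite /steps_end /= => ->; rewrite eqxx; lia.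
  have := steps_end_mult st.2 s; move: e; rewrite /steps_end /= => -> .
  by case=> [ex|xs]; move: mx; rewrite /= !multsE ?ex ?eqxx; lia.
have yT' : (tree_root T' == Some y) = false.
  by apply/eqP/root_neq; clear -my; lia.
have wy : (w == y) = false by clear -my; lia.
case: s e x0 mx an rQ my h h' m => [|st s] e x0 mx an rQ my h h' m.
  have -> : w = x by [].
  have -> : o' = ~~ o by case: o h h' {an rQ e}; case: (o').
  case: o {h h' m an rQ e}; rewrite !(ncorners_cons, ncorners_cat, ncorners_nil) T'0
    ?eqxx ?orbT //;
  by rewrite /ncorner /step_tri /= !(inj_eq (@Some_inj _)) !eqxx [x == y]eq_sym yx
    xT' yT'.
have xs : 0 < mult x (steps_nodes (st :: s)).
  have := steps_end_mult st.2 s; move: e; rewrite /steps_end /= => -> .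
  by case=> [ex|xs]; rewrite /= !multsE ?ex ?eqxx; [|clear -xs]; lia.
have wx : (w == x) = false by clear -mx xs; lia.
have s0 : Some y \notin labels (steps_tris w (st :: s)).
  by apply: steps_labels0; rewrite ?[y == w]eq_sym ?wy //; clear -my; lia.
have s1 u v : (u == y) || (v == y) -> ncorners (steps_tris w (st :: s)) u v = 0.
  by move=> H; apply: ncorners0; case/orP: H => /eqP->; rewrite s0 ?orbT.
move: (steps_tris w (st :: s)) s1 {s0} => ts s1.
case: o {an rQ e h h' m}; rewrite !(ncorners_cons, ncorners_cat) T'0 ?s1 ?eqxx ?orbT //;
rewrite /ncorner /step_tri; case: o'; 
by rewrite /= !(inj_eq (@Some_inj _)) ?eqxx ?[x == y]eq_sym ?yx ?xT' ?yT' ?wx ?wy.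
Qed.

Lemma annulus_edges Q x s1 o T y s2 : annulus Q x (s1 ++ (o, T, y) :: s2) ->
  if o then 0 < Q (steps_end x s1) y else 0 < Q y (steps_end x s1).
Proof. by move=> /annulus_rot /annulus_edge. Qed.

(** The step triangle itself is the cycle. Its corners at [z] are not cancelled, because [x] and [y]
    label nothing inside the tree and [z] labels nothing in the other steps; the third arrow is
    [annulus_edge]. *)
Lemma annulus_3cycle Q x o z A B y s : annulus Q x ((o, Node z A B, y) :: s) ->
  exists a b, [/\ 0 < Q a b, 0 < Q b z & 0 < Q z a].
Proof.
move=> an; have x0 := annulus_start an; have xy := annulus_edge an.
have [rQ m _ _ _] := an; rewrite /= in m; have mx := m x; have my := m y; have mz := m z.
rewrite !multsE ?eqxx in mx my mz.
have yx : (y == x) = false by lia.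
have zx : (z == x) = false by lia.
have yz : (y == z) = false by lia.
have T0 u v : u \in [:: x; y] -> ncorners (tree_tris (Node z A B)) u v = 0 /\
   ncorners (tree_tris (Node z A B)) v u = 0.
  rewrite !inE => H; apply: ncorners_labels; apply: tree_labels0.
  by case/orP: H => /eqP->; rewrite !multsE; lia.
have s0 u : ncorners (steps_tris y s) z u = 0 /\ ncorners (steps_tris y s) u z = 0.
  by apply: ncorners_labels; apply: steps_labels0; rewrite 1?eq_sym ?yz //; lia.
have Ty u := T0 y u (mem_last _ [:: y]).
have Tx u := T0 x u (mem_head _ _).
exists (if o then x else y), (if o then y else x).
have {}rQ : represents Q (step_tri x (o, Node z A B, y) ::
    tree_tris (Node z A B) ++ steps_tris y s) := rQ.
move: (tree_tris _) rQ Tx Ty {T0} => ts rQ Tx Ty.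
case: o xy rQ {an} => xy rQ; split=> //; rewrite rQ;
rewrite !(ncorners_cons, ncorners_cat) ?(proj1 (s0 _)) ?(proj2 (s0 _));
rewrite ?(proj1 (Ty _)) ?(proj2 (Ty _)) ?(proj1 (Tx _)) ?(proj2 (Tx _));
by rewrite /ncorner /step_tri /= !(inj_eq (@Some_inj _)) !eqxx ?[x == y]eq_sym ?[x
  == z]eq_sym ?[z == y]eq_sym ?yx ?zx ?yz.
Qed.

Lemma annulus_acyclic_bare Q (g : V -> nat) x s :
    (forall u v, 0 < Q u v -> g u < g v) ->
  annulus Q x s -> exists ps, s = bare ps.
Proof.
move=> gQ an; have [//|[s1 [o [k [A [B [y [s2 es]]]]]]]] := treesize_split s.
rewrite es in an; have /annulus_3cycle[a [b [/gQ ab /gQ bk /gQ ka]]] := annulus_rot an.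
by lia.
Qed.

Lemma bare_edge x ps u v : 0 < ncorners (steps_tris x (bare ps)) u v ->
  exists2 i, i < size ps &
    let a := nth x (x :: [seq p.2 | p <- ps]) i in
    let b := nth x (x :: [seq p.2 | p <- ps]) i.+1 in
    if nth true [seq p.1 | p <- ps] i then u = a /\ v = b else u = b /\ v = a.
Proof.
elim: ps x => [|[o y] ps IH] x; first by rewrite ncorners_nil.
rewrite /= !(ncorners_cons, ncorners_cat) addn_gt0 => /orP[|/IH[i ilt H]]; last first.
  have nE j : j < (size ps).+1 -> nth y (y :: [seq p.2 | p <- ps]) j = nth x (y ::
    [seq p.2 | p <- ps]) j.
    by move=> jl; apply: set_nth_default; rewrite /= size_map.
  exists i.+1 => //; move: H; cbv zeta; rewrite !nE ?ltnS // 1?ltnW //.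
move=> H; exists 0 => //=; move: H; rewrite /step_tri /ncorner /=.
by case: o; rewrite /= ?addn0 ?mul0n ?muln0 ?addn0 !(inj_eq (@Some_inj _));
  have [->|//] := eqVneq; have [->|] := eqVneq.
Qed.

Lemma sorted_bare_grading Q x ps p q d :
    annulus Q x (bare ps) -> [seq r.1 | r <- ps] = nseq p true ++ nseq q false ->
    p = q %[mod d] ->
  (exists g : V -> nat, forall u v, 0 < Q u v -> g u < g v) /\
  (exists f : V -> nat, forall u v, 0 < Q u v -> f v = (f u).+1 %[mod d]).
Proof.
move=> [rQ m e h h'] ef pq.
set vs := [seq r.2 | r <- ps].
have nE : steps_nodes (bare ps) = vs by rewrite /vs; elim: (ps) => //= r rs ->.
have endE : last x vs = x.
  by rewrite -[RHS]e /steps_end /vs /bare -map_comp.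
have us : uniq vs by apply/uniq_mult => z; rewrite -nE m.
have szv : size vs = p + q.
  by rewrite size_map -(size_map fst) ef size_cat !size_nseq.
have p0 : 0 < p.
  move: h; rewrite /bare has_map -(has_map fst id) ef has_cat !has_nseq andbF orbF.
  by rewrite andbT.
have q0 : 0 < q.
  move: h'; rewrite /bare has_map -(has_map fst negb) ef has_cat !has_nseq andbF.
  by rewrite andbT.
(* The base [x] stands in this list both at 0 and at [p + q]; [index] returns 0. *)
pose idx v := index v (x :: vs).
have idxE i : i < p + q -> idx (nth x (x :: vs) i) = i.
  case: i => [|i] ilt; first by rewrite /idx /= eqxx.
  have ilt' : i < size vs by rewrite szv ltnW.
  rewrite /idx /= index_uniq //; case: eqVneq => // ex.
  have : nth x vs (size vs).-1 = nth x vs i by rewrite nth_last endE.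
  move/eqP; rewrite nth_uniq //; first by move=> /eqP; lia.
  by rewrite szv; lia.
have idx_end : idx (nth x (x :: vs) (p + q)) = 0.
  have -> : nth x (x :: vs) (p + q) = x by rewrite -szv -last_nth.
  by rewrite /idx /= eqxx.
have edge u v : 0 < Q u v -> exists2 i, i < p + q &
    [/\ i < p, idx u = i & idx v = i.+1] \/
    [/\ p <= i, idx v = i & idx u = if i.+1 < p + q then i.+1 else 0].
  rewrite rQ => Quv.
  have /bare_edge[i] : 0 < ncorners (steps_tris x (bare ps)) u v.
    by apply: leq_trans Quv (leq_subr _ _).
  rewrite -(size_map snd) szv ef nth_cat size_nseq !nth_nseq -/vs => ilt H.
  exists i => //; case: (ltnP i p) H => ip.
    by move=> [-> ->]; left; rewrite !idxE //; clear -ip q0; lia.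
  rewrite (_ : i - p < q); last by clear -ip ilt; lia.
  move=> [-> ->]; right; rewrite idxE //; split=> //; case: ifP => [/idxE //|] im.
  by rewrite (_ : i.+1 = p + q); [|clear -im ilt; lia].
split.
  (* The only source is [x] and the only sink has index [p]. The value is the distance from [x]
     along the path, and [p + q] at the sink exceeds all values on both paths. *)
  exists (fun v => if idx v < p then idx v else if idx v == p then p + q else p + q
    - idx v).
  move=> u v /edge[i ilt] [] [ip -> ->]; clear -ip p0 q0 ilt.
    by rewrite ip; case: ifP => ? //; case: ifP => ?; lia.
  have -> : (i < p) = false by lia.
  case: (ltnP i.+1 (p + q)) => im; last by rewrite p0; case: ifP; lia.
  have -> : (i.+1 < p) = false by lia.
  have -> : (i.+1 == p) = false by lia.
  by case: ifP; lia.
(* Up to the sink the arrows are counted from [x]; the second path is counted back from the sink.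
   Its first vertex gets [p + 1] while [x] has [q], which is where [p = q] modulo [d] enters. The
   shift by [q] keeps the subtraction from being truncated. *)
exists (fun v => if idx v <= p then q + idx v else q + 2 * p - idx v).
move=> u v /edge[i ilt] [] [ip -> ->]; clear -ip p0 q0 ilt pq.
  by rewrite (ltnW ip) ip addnS.
case: (ltnP i.+1 (p + q)) => im.
  have -> : (i.+1 <= p) = false by lia.
  by congr (_ %% _); case: ifP; lia.
rewrite leq0n addn0 -(addn1 q) -[RHS]modnDml -pq modnDml addn1.
by congr (_ %% _); case: ifP; lia.
Qed.

(** Along the word [f] changes by one at each step, up or down according to the flag, and it returns
    to its value at [x]. *)
Lemma grading_holonomy Q (f : V -> nat) d x s :
    (forall u v, 0 < Q u v -> f v = (f u).+1 %[mod d]) ->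
    annulus Q x s ->
  count (fun st => st.1.1) s = count (fun st => ~~ st.1.1) s %[mod d].
Proof.
move=> fQ an.
have edge s1 (st : step V) s2 : s = s1 ++ st :: s2 ->
    if st.1.1 then 0 < Q (steps_end x s1) st.2 else 0 < Q st.2 (steps_end x s1).
  by case: st => [[o T] y] es; rewrite es in an; apply: annulus_edges an.
have end_s : steps_end x s = x by have [] := an.
have H s1 s2 : s = s1 ++ s2 ->
    f (steps_end x s1) + count (fun st => ~~ st.1.1) s1 =
    f x + count (fun st => st.1.1) s1 %[mod d].
  elim/last_ind: s1 s2 => [//|s1 st IH] s2 es.
  have {}IH := IH (st :: s2); rewrite -cat_rcons in IH; have {IH} := IH es.
  have := edge s1 st s2; rewrite -cat_rcons => /(_ es).
  rewrite -cats1 !count_cat steps_end_cat /= !addn0.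
  case: st.1.1 => /fQ; rewrite /steps_end /= => E IH.
    by rewrite addn0 addnA -modnDml E modnDml addSn -addn1 -modnDml IH modnDml.
  rewrite addn0 addn1 addnS -addSn -IH -[RHS]modnDml E modnDml //.
have := H s [::]; rewrite cats0 end_s => /(_ erefl).
by move/eqP; rewrite eqn_modDl => /eqP ->.
Qed.

Lemma weight_sum Q x s : annulus Q x s -> weight true s + weight false s = #|V|.
Proof.
move=> [_ m _ _ _].
have -> : weight true s + weight false s = size (steps_nodes s).
  elim: s {m} => [|st s IH]; first by rewrite /weight !big_nil.
  rewrite !weight_cons /= size_cat -IH.
  by case: st.1.1; rewrite /=; lia.
rewrite cardE; apply: perm_size; apply: uniq_perm.
- by apply/uniq_mult => z; rewrite m.
- exact: enum_uniq.
- by move=> z; rewrite mem_enum mem_mult m.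
Qed.

(** The mutations that sort the first annulus are applied to the second. Both then describe one
    quiver: its potential [g] leaves no trees in the second annulus, so weights are numbers of steps
    there, and its grading [f] gives the congruence. *)
Lemma annulus_weight_mod Q x s y s' d : annulus Q x s -> annulus Q y s' ->
  weight true s = weight false s %[mod d] -> weight true s' = weight false s' %[mod d].
Proof.
move=> /annulus_sorted[ks [x' [ps [an w e]]]] an'.
have [y' [s'' [an'' w'']]] := annulus_foldl_mutation ks an'.
move=> /(sorted_bare_grading an e) [[g gQ] [f fQ]].
have [ps' es''] := annulus_acyclic_bare gQ an''.
have := grading_holonomy fQ an''.
suff wE b : weight b s' = count (fun st => st.1.1 == b) s''.
  rewrite !wE => E; rewrite (eq_count (a2 := fun st => st.1.1)) ?E.
    by congr (_ %% _); apply: eq_count => st; case: st.1.1.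
  by move=> st; case: st.1.1.
rewrite -w'' es'' /weight -sum1_count /bare !big_map.
by apply: eq_bigr.
Qed.

(** With [d] arbitrary, 0 included, the absolute differences of the two pairs have the same divisors
    and are equal; the sums are both [#|V|]. *)
Lemma annulus_weight_unique Q x s y s' : annulus Q x s -> annulus Q y s' ->
  weight true s = weight true s' /\ weight false s = weight false s' \/
  weight true s = weight false s' /\ weight false s = weight true s'.
Proof.
move=> an an'; have := weight_sum an; rewrite -(weight_sum an').
have H d := annulus_weight_mod (d := d) an an'.
have H' d := annulus_weight_mod (d := d) an' an.
move: H H' {an an'}.
move: (weight true s) (weight false s) (weight true s') (weight false s') => p q p'
  q' H H' E.
have dist a b d : (a == b %[mod d]) = (d %| (a - b) + (b - a)).
  have [ab|ba] := leqP a b.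
    by rewrite eq_sym eqn_mod_dvd // (eqP ab) add0n.
  by rewrite eqn_mod_dvd ?(ltnW ba) // (eqP (ltnW ba)) addn0.
have {}H d : d %| (p - q) + (q - p) -> d %| (p' - q') + (q' - p').
  by rewrite -!dist => /eqP/H/eqP.
have {}H' d : d %| (p' - q') + (q' - p') -> d %| (p - q) + (q - p).
  by rewrite -!dist => /eqP/H'/eqP.
have : (p - q) + (q - p) = (p' - q') + (q' - p').
  by apply/eqP; rewrite eqn_dvd H ?dvdnn // H' ?dvdnn.
lia.
Qed.

End Uniqueness.

(** * Quivers of type A *)

Section Polygon.
Variable V : finType.
Implicit Types (Q : quiver V) (T L R X Y C D : tree V) (x y z : V).

(* The distinguished boundary edge lies in a triangle with further sides the
   roots of [L] and [R]. *)
Definition polygon Q L R : Prop :=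
  represents Q ((None, tree_root L, tree_root R) :: tree_tris L ++ tree_tris R) /\
  forall x, mult x (nodes L) + mult x (nodes R) = 1.

Lemma polygon_mutation Q L R k : polygon Q L R ->
  exists L' R', polygon (mutation Q k) L' R'.
Proof.
move=> [rQ m]; have [||L' [R' [m' fl]]] := @flip_tree _ None L R k.
- by move=> x; rewrite m.
- by rewrite m.
by exists L', R'; split; [apply: represents_flips rQ | move=> x; rewrite m'].
Qed.

Lemma polygon_foldl_mutation Q L R ks : polygon Q L R ->
  exists L' R', polygon (foldl (@mutation V) Q ks) L' R'.
Proof.
elim: ks Q L R => [|k ks IH] Q L R pQ; first by exists L, R.
by have [L' [R' /IH]] := polygon_mutation k pQ.
Qed.

(** The triangulation of a linearly ordered path: a left child receives an arrow from its parent and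
    a right child sends one to it, so each arrow decides the side. With one child per node, no
    further corners arise. *)
Fixpoint comb Q (s : seq V) : tree V :=
  if s is x :: s' then
    if s' is y :: _ then
      if 0 < Q x y then Node x (comb Q s') Leaf else Node x Leaf (comb Q s')
    else Node x Leaf Leaf
  else Leaf.

(** The default [x] of [head] covers the end of the path: there are no loops, so the second branch
    is taken. *)
Lemma comb_cons Q x s : comb Q (x :: s) =
  if 0 < Q x (head x s) then Node x (comb Q s) Leaf else Node x Leaf (comb Q s).
Proof. by case: s => //=; rewrite arr_loop. Qed.

Lemma nodes_comb Q s : nodes (comb Q s) = s.
Proof.
by elim: s => // x s IH; rewrite comb_cons; case: ifP => _; rewrite /= IH ?cats0.
Qed.

Lemma tree_root_comb Q s : tree_root (comb Q s) = ohead s.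
Proof. by case: s => // x s; rewrite comb_cons; case: ifP. Qed.

Lemma comb_tris Q s :
    uniq s ->
    {in s &, forall x y,
      Q x y + Q y x = (index y s == (index x s).+1) + (index x s == (index y s).+1)} ->
  {in s &, forall x y,
    Q x y = ncorners (tree_tris (comb Q s)) x y - ncorners (tree_tris (comb Q s)) y x}.
Proof.
elim: s => // a s IH /andP[aNs us] H.
have {}IH : {in s &, forall x y,
    Q x y = ncorners (tree_tris (comb Q s)) x y - ncorners (tree_tris (comb Q s)) y x}.
  apply: IH => // x y xs ys; have := H x y; rewrite !inE xs ys !orbT /=.
  have [eax|_] := eqVneq a x; first by rewrite eax xs in aNs.
  have [eay|_] := eqVneq a y; first by rewrite eay ys in aNs.
  by rewrite !eqSS => ->.
have Qa y : y \in s -> Q a y + Q y a = (ohead s == Some y).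
  move=> ys; have := H a y; rewrite !inE ys eqxx orbT /= eqxx => -> //.
  have [eay|_] := eqVneq a y; first by rewrite eay ys in aNs.
  by case: (s) ys => //= b s' _; rewrite (inj_eq (@Some_inj _)); case: (b == y).
have a0 : forall y, ncorners (tree_tris (comb Q s)) a y = 0 /\
    ncorners (tree_tris (comb Q s)) y a = 0.
  apply: ncorners_labels; apply: tree_labels0; rewrite nodes_comb.
  by move: aNs; rewrite mem_mult; case: mult.
(* A new top vertex [a] adds a single corner, joining it to the head of [s]. *)
have sE : if 0 < Q a (head a s) then forall x y, ncorners (tree_tris (comb Q (a ::
  s))) x y =
      (a == x) * (ohead s == Some y) + ncorners (tree_tris (comb Q s)) x y
    else forall x y, ncorners (tree_tris (comb Q (a :: s))) x y =
      (ohead s == Some x) * (a == y) + ncorners (tree_tris (comb Q s)) x y.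
  rewrite comb_cons; case: (0 < Q a (head a s)) => x y;
  rewrite /= !(ncorners_cons, ncorners_cat, ncorners_nil) /ncorner /=;
  by rewrite tree_root_comb !(inj_eq (@Some_inj _)); lia.
have hd y : ohead s = Some y -> head a s = y by case: (s) => //= b s' [].
have ha : (ohead s == Some a) = false.
  by case: (s) aNs => //= b s'; rewrite inE negb_or => /andP[ab _];
    apply/eqP => -[e]; rewrite e eqxx in ab.
have sa x : x \in s -> (a == x) = false.
  by move=> xs; apply/eqP => e; rewrite e xs in aNs.
move=> x y; rewrite !inE => /orP[/eqP->|xs] /orP[/eqP->|ys].
- by rewrite arr_loop subnn.
- have [a1 a2] := a0 y; have := Qa y ys.
  case: ifP sE => Qh sE; rewrite !sE ha (sa y ys) eqxx ?a1 ?a2.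
    by case: eqP => [/hd e|_]; rewrite ?e in Qh; have := @arr_2cycle _ Q a y; lia.
  by case: eqP => [/hd e|_]; rewrite ?e in Qh; have := @arr_2cycle _ Q a y; lia.
- have [a1 a2] := a0 x; have := Qa x xs.
  case: ifP sE => Qh sE; rewrite !sE ha (sa x xs) eqxx ?a1 ?a2.
    by case: eqP => [/hd e|_]; rewrite ?e in Qh; have := @arr_2cycle _ Q a x; lia.
  by case: eqP => [/hd e|_]; rewrite ?e in Qh; have := @arr_2cycle _ Q a x; lia.
- by case: ifP sE => Qh sE; rewrite !sE !sa // ?mul0n ?muln0 IH.
Qed.

(* The sides of [T] and of the polygon [C], [D] across its root are cut along
   [z] instead. *)
Lemma reroot T C D z : 0 < mult z (nodes T) ->
  exists X Y C' D',
    (forall x, (z == x) + (mult x (nodes X) + mult x (nodes Y)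
        + (mult x (nodes C') + mult x (nodes D'))) =
      mult x (nodes T) + (mult x (nodes C) + mult x (nodes D))) /\
    ncorners (tree_tris (Node z X Y) ++ tree_tris (Node z C' D')) =2
    ncorners (tree_tris T ++ (tree_root T, tree_root C, tree_root D)
      :: tree_tris C ++ tree_tris D).
Proof.
elim: T C D => // v A IHA B IHB C D; rewrite !multsE.
have [-> _|_ /=] := eqVneq v z; first by exists A, B, C, D; split=> // x; rewrite
  !multsE; lia.
(* Moving one level down: across the root of [B] lies the triangle with sides [v] and [A], where [v]
   now carries [C] and [D]; across the root of [A] the sides are [B] and [v]. *)
have [zA|zA] := posnP (mult z (nodes A)).
  rewrite zA => /(IHB (Node v C D) A)[X [Y [C' [D' [m e]]]]].
  exists X, Y, C', D'; split=> [x|x y]; first by rewrite m !multsE; lia.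
  rewrite e /= !(ncorners_cons, ncorners_cat) (ncorner_rot (tree_root B)); lia.
move=> _; have [X [Y [C' [D' [m e]]]]] := IHA B (Node v C D) zA.
exists X, Y, C', D'; split=> [x|x y]; first by rewrite m !multsE; lia.
rewrite e /= !(ncorners_cons, ncorners_cat) -(ncorner_rot (Some v)); lia.
Qed.

Lemma tree_root_le_mult T x : (tree_root T == Some x) <= mult x (nodes T).
Proof. by case: eqP => // /root_mult. Qed.

Lemma sum_tree_root T : \sum_x (tree_root T == Some x) = (if T is Leaf then 0 else 1).
Proof.
case: T => [|z l r]; first by rewrite big1.
rewrite (bigD1 z) //= eqxx big1 ?addn0 // => x xz.
by rewrite (inj_eq (@Some_inj _)) eq_sym (negPf xz).
Qed.

(** As a diagonal, [z] separates polygons [X], [Y] and [C], [D], and its valency is the number of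
    non-leaves among the four. If one pair consists of leaves, the other polygon is the tree.
    Otherwise there is one neighbour on each side, and these two are not joined, against the
    3-cycle. *)
Lemma polygon_rooted Q L R z :
    polygon Q L R ->
    \sum_x (Q z x + Q x z) <= 2 ->
    (\sum_x (Q z x + Q x z) = 2 -> exists a b, [/\ 0 < Q z a, 0 < Q a b & 0 < Q b z]) ->
  exists T, [/\ tree_root T = Some z, forall x, mult x (nodes T) = 1
    & represents Q (tree_tris T)].
Proof.
move=> [rQ m] val cyc.
have [X [Y [C [D [m' e']]]]] : exists X Y C D,
    (forall x, (z == x) + (mult x (nodes X) + mult x (nodes Y)
        + (mult x (nodes C) + mult x (nodes D))) = 1) /\
    ncorners (tree_tris (Node z X Y) ++ tree_tris (Node z C D)) =2
    ncorners ((None, tree_root L, tree_root R) :: tree_tris L ++ tree_tris R).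
  (* After rerooting, the distinguished boundary edge becomes an ordinary leaf. *)
  have [zL|zL] := posnP (mult z (nodes L)).
    have [X [Y [C [D [m' e']]]]] := @reroot R Leaf L z ltac:(by rewrite -(m z) zL).
    exists X, Y, C, D; split=> [x|x y]; first by rewrite m' mult_nil -(m x); lia.
    rewrite e' /= !(ncorners_cons, ncorners_cat, ncorners_nil).
    by rewrite (ncorner_rot (tree_root R)); lia.
  have [X [Y [C [D [m' e']]]]] := @reroot L R Leaf z zL.
  exists X, Y, C, D; split=> [x|x y]; first by rewrite m' mult_nil -(m x); lia.
  rewrite e' /= !(ncorners_cons, ncorners_cat, ncorners_nil).
  by rewrite -(ncorner_rot None); lia.
have {}rQ : represents Q (tree_tris (Node z X Y) ++ tree_tris (Node z C D)).
  by apply: represents_eq rQ => x y; rewrite e'.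
have rootsE x : (tree_root X == Some x) + (tree_root Y == Some x) +
    ((tree_root C == Some x) + (tree_root D == Some x)) <= 1.
  have := m' x; have := tree_root_le_mult X x; have := tree_root_le_mult Y x.
  have := tree_root_le_mult C x; have := tree_root_le_mult D x; clear; lia.
have out T x y : mult z (nodes T) = 0 ->
    ncorners (tree_tris T) z x = 0 /\ ncorners (tree_tris T) x z = 0.
  by move=> /tree_labels0/ncorners_labels.
have mz := m' z; rewrite eqxx in mz.
have [zX zY zC zD] : [/\ mult z (nodes X) = 0, mult z (nodes Y) = 0,
    mult z (nodes C) = 0 & mult z (nodes D) = 0] by clear -mz; split; lia.
have rz T : mult z (nodes T) = 0 -> (tree_root T == Some z) = false.
  by move=> zT; apply/eqP/root_neq.
have Nz x : ncorners (tree_tris (Node z X Y) ++ tree_tris (Node z C D)) z x =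
    (tree_root X == Some x) + (tree_root C == Some x).
  rewrite /= !(ncorners_cons, ncorners_cat) /ncorner /= eqxx !rz //.
  by rewrite !(proj1 (out _ x x _)) //; clear; lia.
have Nz' x : ncorners (tree_tris (Node z X Y) ++ tree_tris (Node z C D)) x z =
    (tree_root Y == Some x) + (tree_root D == Some x).
  rewrite /= !(ncorners_cons, ncorners_cat) /ncorner /= eqxx !rz //.
  by rewrite !(proj2 (out _ x x _)) //; clear; lia.
have QE x : Q z x + Q x z = (tree_root X == Some x) + (tree_root Y == Some x) +
    ((tree_root C == Some x) + (tree_root D == Some x)).
  by rewrite !rQ !Nz !Nz'; have := rootsE x; clear; lia.
have sumE : \sum_x (Q z x + Q x z) =
    \sum_x (tree_root X == Some x) + \sum_x (tree_root Y == Some x) +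
    (\sum_x (tree_root C == Some x) + \sum_x (tree_root D == Some x)).
  by rewrite -!big_split; apply: eq_bigr => x _; rewrite QE.
rewrite sumE !sum_tree_root in val cyc.
have leafXY A B : A = Leaf -> B = Leaf -> ncorners (tree_tris (Node z A B)) =2 fun _
  _ => 0.
  by move=> -> -> x y; rewrite /= ncorners_cons ncorners_nil /ncorner /= muln0.
have [eXY|nXY] : {X = Leaf /\ Y = Leaf} + {0 < (if X is Leaf then 0 else 1) + (if Y
  is Leaf then 0 else 1)}.
  by case: (X); case: (Y); [left|right..].
  have [eX eY] := eXY; exists (Node z C D); split=> //.
    by move=> x; rewrite -(m' x) eX eY !multsE; lia.
  by apply: represents_eq rQ => x y; rewrite ncorners_cat leafXY.
have [eCD|nCD] : {C = Leaf /\ D = Leaf} + {0 < (if C is Leaf then 0 else 1) + (if D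
  is Leaf then 0 else 1)}.
  by case: (C); case: (D); [left|right..].
  have [eC eD] := eCD; exists (Node z X Y); split=> //.
    by move=> x; rewrite -(m' x) eC eD !multsE; lia.
  by apply: represents_eq rQ => x y; rewrite ncorners_cat addnC leafXY.
(* [z] would have exactly one neighbour on each of its two sides, and the
   sides are not joined by arrows. *)
have {cyc} [|a [b [za ab bz]]] := cyc; first by clear -val nXY nCD; lia.
have eX1 : (if X is Leaf then 0 else 1) + (if Y is Leaf then 0 else 1) = 1.
  by clear -val nXY nCD; lia.
have eC1 : (if C is Leaf then 0 else 1) + (if D is Leaf then 0 else 1) = 1.
  by clear -val nXY nCD; lia.
have side A B x y : (if A is Leaf then 0 else 1) + (if B is Leaf then 0 else 1) = 1 ->
    tree_root A = Some x -> tree_root B = Some y -> False.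
  by case: A => //; case: B.
have sep (A B A' B' : tree V) (x y : V) : 0 < mult x (nodes A) + mult x (nodes B) ->
    0 < mult y (nodes A') + mult y (nodes B') -> 
    (forall w, (z == w) + (mult w (nodes A) + mult w (nodes B)
        + (mult w (nodes A') + mult w (nodes B'))) = 1) ->
    ncorners (tree_tris (Node z A B) ++ tree_tris (Node z A' B')) x y = 0.
  move=> xA yA mw; rewrite ncorners_cat.
  have mx := mw x; have my := mw y.
  rewrite [X in X + _]ncorners0; last first.
    by apply/orP; right; apply: tree_labels0; rewrite !multsE; clear -my yA; lia.
  rewrite ncorners0 //.
  by apply/orP; left; apply: tree_labels0; rewrite !multsE; clear -mx xA; lia.
move: ab; rewrite rQ.
have : 0 < (tree_root X == Some a) + (tree_root C == Some a).
  by move: za; rewrite rQ Nz Nz'; clear; lia.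
have : 0 < (tree_root Y == Some b) + (tree_root D == Some b).
  by move: bz; rewrite rQ Nz Nz'; clear; lia.
case: (eqVneq (tree_root Y) (Some b)) => [/[dup] Yb /root_mult Yb'|_].
  case: (eqVneq (tree_root X) (Some a)) => [Xa|_]; first by case: (side _ _ _ _ eX1
    Xa Yb).
  case: (eqVneq (tree_root C) (Some a)) => [/root_mult Ca|//] _ _.
  rewrite ncorners_cat addnC -ncorners_cat sep //; first by clear -Ca; lia.
    by clear -Yb'; lia.
  by move=> w; rewrite -(m' w); clear; lia.
case: (eqVneq (tree_root D) (Some b)) => [/[dup] Db /root_mult Db'|//] _.
case: (eqVneq (tree_root C) (Some a)) => [Ca|_]; first by case: (side _ _ _ _ eC1 Ca Db).
case: (eqVneq (tree_root X) (Some a)) => [/root_mult Xa|//] _.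
rewrite sep //; first by clear -Xa; lia.
by clear -Db'; lia.
Qed.

End Polygon.

Lemma orientation_polygon k (Q : quiver 'I_k) :
  orientation_of_A Q -> exists L R, polygon Q L R.
Proof.
move=> oQ; exists (comb Q (enum 'I_k)), Leaf; split.
  move=> x y; rewrite (comb_tris (enum_uniq _) _ (mem_enum _ x) (mem_enum _ y)).
    by rewrite cats0 !ncorners_cons /ncorner /= !muln0.
  by move=> i j _ _; rewrite !index_enum_ord oQ.
move=> x; rewrite nodes_comb addn0; apply/eqP; rewrite eqn_leq.
by rewrite -mem_mult mem_enum andbT; move: x; apply/uniq_mult/enum_uniq.
Qed.

Lemma type_A_polygon k (V : finType) (Q : quiver V) :
  type_A k Q -> exists L R, polygon Q L R.
Proof.
move=> [L0 /orientation_polygon[L [R pL]] [ks [f [g fK gK] ef]]].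
have [L' [R' [rQ m]]] := polygon_foldl_mutation ks pL.
exists (tree_map f L'), (tree_map f R'); split; last first.
  by move=> x; rewrite -[x]gK !nodes_map !mult_map //; apply: can_inj fK.
move=> x y; rewrite -[x]gK -[y]gK ef rQ.
have fI := can_inj fK.
by rewrite -!(ncorners_map fI) /= !map_cat !tree_tris_map !tree_root_map.
Qed.

(** * Counting arrows and 3-cycles *)

Section ThreeCycles.
Variable V : finType.
Implicit Types (M N : V -> V -> nat) (x y z w : V) (S : {set V}).

(** Stated for plain functions so as to apply to corner counts of subtrees; on a quiver these
    notions unfold to those of the statement. *)
Definition in_3cycle M x y : bool := [exists w, (0 < M y w) && (0 < M w x)].

Definition cycle3 M S : bool :=
  [exists x, exists y, exists w,
    [&& S == [set x; y; w], 0 < M x y, 0 < M y w & 0 < M w x]].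

Definition loose_arrows M : nat := \sum_x \sum_y (~~ in_3cycle M x y) * M x y.

Definition cycles3 M : {set {set V}} := [set S | cycle3 M S].

Lemma cycle3P M S : reflect
  (exists x y w, [/\ S = [set x; y; w], 0 < M x y, 0 < M y w & 0 < M w x])
  (cycle3 M S).
Proof.
apply: (iffP existsP) => [[x /existsP[y /existsP[w /and4P[/eqP eS xy yw wx]]]]|].
  by exists x, y, w.
move=> [x [y [w [-> xy yw wx]]]]; exists x; apply/existsP; exists y.
by apply/existsP; exists w; rewrite eqxx xy yw wx.
Qed.

Section Node.
Variables (z : V) (l r : tree V).
Let T := Node z l r.
Hypothesis uT : forall x, mult x (nodes T) <= 1.
Let N := ncorners (tree_tris T).
Let Nl := ncorners (tree_tris l).
Let Nr := ncorners (tree_tris r).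

Let NE x y : N x y = (z == x) * (tree_root l == Some y)
  + (tree_root l == Some x) * (tree_root r == Some y)
  + (tree_root r == Some x) * (z == y) + (Nl x y + Nr x y).
Proof.
by rewrite /N /= ncorners_cons ncorners_cat /ncorner /= !(inj_eq (@Some_inj _)).
Qed.

Let outl x y : mult x (nodes l) = 0 -> Nl x y = 0 /\ Nl y x = 0.
Proof. by move=> /tree_labels0/ncorners_labels. Qed.

Let outr x y : mult x (nodes r) = 0 -> Nr x y = 0 /\ Nr y x = 0.
Proof. by move=> /tree_labels0/ncorners_labels. Qed.

Let inl x y : 0 < Nl x y -> 0 < mult x (nodes l) /\ 0 < mult y (nodes l).
Proof.
have [/(outl y)[-> _] //|xl] := posnP (mult x (nodes l)).
by have [/(outl x)[_ ->] //|yl] := posnP (mult y (nodes l)).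
Qed.

Let inr x y : 0 < Nr x y -> 0 < mult x (nodes r) /\ 0 < mult y (nodes r).
Proof.
have [/(outr y)[-> _] //|xl] := posnP (mult x (nodes r)).
by have [/(outr x)[_ ->] //|yl] := posnP (mult y (nodes r)).
Qed.

Let uT' x : (z == x) + (mult x (nodes l) + mult x (nodes r)) <= 1.
Proof. by have := uT x; rewrite !multsE. Qed.

(** As labels are unique, the five origins of an arrow exclude each other, so the index can give its
    exact multiplicity. *)
Variant node_arrow x y : nat -> Prop :=
  | InLeft of 0 < Nl x y & 0 < mult x (nodes l) & 0 < mult y (nodes l) :
      node_arrow x y (Nl x y)
  | InRight of 0 < Nr x y & 0 < mult x (nodes r) & 0 < mult y (nodes r) :
      node_arrow x y (Nr x y)
  | RootLeft of z == x & tree_root l = Some y & 0 < mult y (nodes l) :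
      node_arrow x y 1
  | LeftRight of tree_root l = Some x & tree_root r = Some y
      & 0 < mult x (nodes l) & 0 < mult y (nodes r) : node_arrow x y 1
  | RightRoot of tree_root r = Some x & z == y & 0 < mult x (nodes r) :
      node_arrow x y 1.

Let node_arrowP x y : 0 < N x y -> node_arrow x y (N x y).
Proof.
rewrite NE; have ux := uT' x; have uy := uT' y.
have rl t := tree_root_le_mult l t; have rr t := tree_root_le_mult r t.
have rlx := rl x; have rly := rl y; have rrx := rr x; have rry := rr y.
have [nl|nl] := posnP (Nl x y); last first.
  have [xl yl] := inl nl.
  have [-> ->] : (z == x) = false /\ (z == y) = false by clear -ux uy xl yl; split; lia.
  have xr : mult x (nodes r) = 0 by clear -ux xl; lia.
  have yr : mult y (nodes r) = 0 by clear -uy yl; lia.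
  have [-> _] := outr y xr.
  rewrite (_ : (tree_root r == Some y) = false) ?muln0; last by clear -rry yr; lia.
  by rewrite ?muln0 ?mul0n ?addn0 ?add0n => _; apply: InLeft.
rewrite nl; have [nr|nr] := posnP (Nr x y); last first.
  have [xr yr] := inr nr.
  have [-> ->] : (z == x) = false /\ (z == y) = false by clear -ux uy xr yr; split; lia.
  have xl : mult x (nodes l) = 0 by clear -ux xr; lia.
  rewrite (_ : (tree_root l == Some x) = false) ?muln0; last by clear -rlx xl; lia.
  by rewrite ?muln0 ?mul0n ?addn0 ?add0n => _; apply: InRight.
rewrite nr addn0.
case: (eqVneq (tree_root l) (Some y)) => [rly1|_].
  have yl := root_mult rly1.
  have zy : (z == y) = false by clear -yl uy; lia.
  have nry : (tree_root r == Some y) = false by clear -yl uy rry; lia.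
  rewrite nry zy !muln0 !addn0 muln1; case: (boolP (z == x)) => // zx _.
  exact: RootLeft.
rewrite muln0 add0n.
case: (eqVneq (tree_root l) (Some x)) => [rlx1|_].
  have xl := root_mult rlx1.
  have nrx : (tree_root r == Some x) = false by clear -xl ux rrx; lia.
  rewrite nrx addn0 mul1n; case: (eqVneq (tree_root r) (Some y)) => // rry1 _.
  by apply: LeftRight => //; apply: root_mult.
case: (eqVneq (tree_root r) (Some x)) => // rrx1.
case: (boolP (z == y)) => // zy _.
by apply: RightRoot => //; apply: root_mult.
Qed.

Let leNl x y : Nl x y <= N x y. Proof. by rewrite NE; clear; lia. Qed.
Let leNr x y : Nr x y <= N x y. Proof. by rewrite NE; clear; lia. Qed.

Lemma node_no_2cycle :
  (forall x y, 0 < Nl x y -> Nl y x = 0) -> (forall x y, 0 < Nr x y -> Nr y x = 0) ->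
  forall x y, 0 < N x y -> N y x = 0.
Proof.
move=> hl hr x y xy; apply/eqP; rewrite -leqn0 leqNgt; apply/negP => yx.
have ux := uT' x; have uy := uT' y.
case: (node_arrowP xy); case: (node_arrowP yx) => *;
  try by lia.
  by have := hl x y; lia.
by have := hr x y; lia.
Qed.

(** Between the blocks [z], [l], [r] arrows only run [z -> l -> r -> z]. Three arrows that close up
    either stay in one block or advance each time, and then they are the corners of the top
    triangle. *)
Lemma node_3cycle x y w : 0 < N x y -> 0 < N y w -> 0 < N w x ->
  [\/ [/\ 0 < Nl x y, 0 < Nl y w & 0 < Nl w x],
      [/\ 0 < Nr x y, 0 < Nr y w & 0 < Nr w x]
    | exists a b, [/\ tree_root l = Some a, tree_root r = Some b
        & [\/ [/\ x = z, y = a & w = b], [/\ x = a, y = b & w = z]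
            | [/\ x = b, y = z & w = a]]]].
Proof.
move=> xy yw wx; have ux := uT' x; have uy := uT' y; have uw := uT' w.
case: (node_arrowP xy); case: (node_arrowP yw); case: (node_arrowP wx);
  try (by move=> *; constructor 1); try (by move=> *; constructor 2);
  move=> *; try (exfalso; lia).
- by constructor 3; exists y, w; split=> //; constructor 1; split=> //; apply/esym/eqP.
- by constructor 3; exists x, y; split=> //; constructor 2; split=> //; apply/esym/eqP.
- by constructor 3; exists w, x; split=> //; constructor 3; split=> //; apply/esym/eqP.
Qed.

Let both := (tree_root l != None) && (tree_root r != None).

Let bothP : reflect (exists a b, tree_root l = Some a /\ tree_root r = Some b) both.
Proof.
apply: (iffP andP) => [[]|[a [b [-> ->]]] //].
by case: (tree_root l) (tree_root r) => [a|] // [b|] // _ _; exists a, b.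
Qed.

Let top_cycle a b : tree_root l = Some a -> tree_root r = Some b ->
  [/\ 0 < N z a, 0 < N a b & 0 < N b z].
Proof. by move=> ra rb; rewrite !NE ra rb !eqxx; split; lia. Qed.

Let in_3cycle_top x y : 0 < N x y -> Nl x y = 0 -> Nr x y = 0 -> in_3cycle N x y = both.
Proof.
move=> xy nl nr; apply/idP/bothP => [/existsP[w /andP[yw wx]]|[a [b [ra rb]]]].
  case: (node_3cycle xy yw wx) => [[]|[]|[a [b [ra rb _]]]]; rewrite ?nl ?nr //.
  by exists a, b.
have [za ab bz] := top_cycle ra rb; apply/existsP.
case: (node_arrowP xy); rewrite ?nl ?nr // ?ra ?rb => + + *.
- by move=> /eqP <- [<-]; exists b; rewrite ab bz.
- by move=> [<-] [<-]; exists z; rewrite bz za.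
- by move=> [<-] /eqP <-; exists a; rewrite za ab.
Qed.

Let in_3cycle_sub M x y : (M = Nl \/ M = Nr) -> 0 < M x y ->
  in_3cycle N x y = in_3cycle M x y.
Proof.
move=> eM xy.
have leM u v : M u v <= N u v by case: eM => ->; [apply: leNl|apply: leNr].
have xyN := leq_trans xy (leM _ _); have ux := uT' x; have uy := uT' y.
apply/existsP/existsP => -[w /andP[yw wx]]; last first.
  by exists w; rewrite (leq_trans yw) ?(leq_trans wx).
exists w; case: (node_3cycle xyN yw wx) => [[xyl ywl wxl]|[xyr ywr wxr]|[a [b [ra rb
  H]]]].
- case: eM xy => -> xy; first by rewrite ywl wxl.
  by have [xr _] := inr xy; have [xl _] := inl xyl; lia.
- case: eM xy => -> xy; last by rewrite ywr wxr.
  by have [xr _] := inr xyr; have [xl _] := inl xy; lia.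
- have := root_mult ra; have := root_mult rb.
  have := uT' z; rewrite eqxx; have := uT' a; have := uT' b.
  have xyM : 0 < mult x (nodes l) /\ 0 < mult y (nodes l) \/
             0 < mult x (nodes r) /\ 0 < mult y (nodes r).
    by case: eM xy => -> xy; [left; apply: inl|right; apply: inr].
  clear -H xyM; case: H => -[ex ey ew]; subst x y w; lia.
Qed.

(** Arrows of a subtree keep their status. Those of the top triangle are loose exactly when a child
    is empty, and then the corner from [l] to [r] is absent. *)
Lemma node_loose x y : (~~ in_3cycle N x y) * N x y =
  ~~ both * ((z == x) * (tree_root l == Some y) + (tree_root r == Some x) * (z == y))
  + (~~ in_3cycle Nl x y * Nl x y + ~~ in_3cycle Nr x y * Nr x y).
Proof.
have ux := uT' x; have uy := uT' y.
have rl t := tree_root_le_mult l t; have rr t := tree_root_le_mult r t.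
have rlx := rl x; have rly := rl y; have rrx := rr x; have rry := rr y.
have [n0|xy] := posnP (N x y).
  have e := NE x y; rewrite n0 muln0 in e *.
  have [-> ->] : Nl x y = 0 /\ Nr x y = 0 by clear -e; split; lia.
  by rewrite !muln0 addn0; case: both; rewrite ?mul1n ?mul0n //; clear -e; lia.
have [nl|nl] := posnP (Nl x y); last first.
  have [xl yl] := inl nl.
  rewrite (in_3cycle_sub (or_introl erefl) nl).
  have xr : mult x (nodes r) = 0 by clear -ux xl; lia.
  have [-> _] := outr y xr.
  have [zx zy] : (z == x) = false /\ (z == y) = false by clear -ux uy xl yl; split; lia.
  rewrite zx zy !muln0 addn0; congr (_ * _); rewrite NE zx zy.
  have [-> _] := outr y xr.
  have -> : (tree_root r == Some y) = false by clear -uy yl rry; lia.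
  by rewrite ?mul0n ?muln0 ?mul0n ?addn0 ?add0n.
have [nr|nr] := posnP (Nr x y); last first.
  have [xr yr] := inr nr.
  rewrite (in_3cycle_sub (or_intror erefl) nr) nl.
  have xl : mult x (nodes l) = 0 by clear -ux xr; lia.
  have [zx zy] : (z == x) = false /\ (z == y) = false by clear -ux uy xr yr; split; lia.
  rewrite zx zy !muln0 !add0n; congr (_ * _); rewrite NE zx zy nl.
  have -> : (tree_root l == Some x) = false by clear -xl rlx; lia.
  by rewrite ?mul0n ?muln0 ?mul0n ?addn0 ?add0n.
rewrite (in_3cycle_top xy nl nr) nl nr !muln0 !addn0 NE nl nr !addn0.
case eb: both; first by rewrite !mul0n.
rewrite !mul1n; suff -> : (tree_root l == Some x) * (tree_root r == Some y) = 0 by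
  rewrite addn0.
move: eb; rewrite /both; case: eqVneq => [->|_] //=.
by case: eqVneq => [->|_]; rewrite ?muln0.
Qed.

Lemma node_loose_arrows : loose_arrows N =
  ~~ both * ((tree_root l != None) + (tree_root r != None)) + (loose_arrows Nl +
    loose_arrows Nr).
Proof.
have sumE (U : tree V) : \sum_y (tree_root U == Some y) = (tree_root U != None).
  by rewrite sum_tree_root; case: U.
have -> : ~~ both * ((tree_root l != None) + (tree_root r != None)) = \sum_x \sum_y
    ~~ both * ((z == x) * (tree_root l == Some y) + (tree_root r == Some x) * (z == y)).
  rewrite (eq_bigr (fun x => ~~ both * ((z == x) * (tree_root l != None) +
    (tree_root r == Some x)))).
    rewrite -big_distrr big_split /= sumE; congr (_ * (_ + _)).
    rewrite (bigD1 z) //= eqxx mul1n big1 ?addn0 // => x xz.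
    by rewrite eq_sym (negPf xz).
  move=> x _; rewrite -big_distrr /= big_split /= -!big_distrr /= sumE.
  congr (_ * (_ + _)); rewrite (bigD1 z) //= eqxx big1 ?addn0 ?muln1 // => y yz.
  by rewrite eq_sym (negPf yz).
rewrite /loose_arrows -!big_split /=; apply: eq_bigr => x _.
by rewrite -!big_split /=; apply: eq_bigr => y _; apply: node_loose.
Qed.

Let cyclesl S : S \in cycles3 Nl -> [/\ exists x, x \in S, z \notin S &
  forall x, x \in S -> 0 < mult x (nodes l)].
Proof.
rewrite inE => /cycle3P[x [y [w [-> xy yw wx]]]].
have [[xl yl] [_ wl]] := (inl xy, inl yw).
have H t : t \in [set x; y; w] -> 0 < mult t (nodes l).
  by rewrite !inE => /orP[/orP[]|] /eqP->.
split=> //; first by exists x; rewrite !inE eqxx.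
by apply/negP => /H; have := uT' z; rewrite eqxx; lia.
Qed.

Let cyclesr S : S \in cycles3 Nr -> [/\ exists x, x \in S, z \notin S &
  forall x, x \in S -> 0 < mult x (nodes r)].
Proof.
rewrite inE => /cycle3P[x [y [w [-> xy yw wx]]]].
have [[xl yl] [_ wl]] := (inr xy, inr yw).
have H t : t \in [set x; y; w] -> 0 < mult t (nodes r).
  by rewrite !inE => /orP[/orP[]|] /eqP->.
split=> //; first by exists x; rewrite !inE eqxx.
by apply/negP => /H; have := uT' z; rewrite eqxx; lia.
Qed.

Lemma node_cycles3 : #|cycles3 N| = both + (#|cycles3 Nl| + #|cycles3 Nr|).
Proof.
(* The cycles through [z] are at most the top triangle; all others lie in one subtree. *)
pose top : {set {set V}} := [set S in cycles3 N | z \in S].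
have sub M S : (M = Nl \/ M = Nr) -> cycle3 M S -> cycle3 N S.
  move=> eM /cycle3P[x [y [w [-> xy yw wx]]]]; apply/cycle3P; exists x, y, w.
  have leM u v : M u v <= N u v by case: eM => ->; [apply: leNl|apply: leNr].
  by split=> //; apply: leq_trans (leM _ _).
have topE : top = if both then [set [set z; odflt z (tree_root l); odflt z
  (tree_root r)]] else set0.
  apply/setP => S; rewrite !inE; apply/andP/idP => [[/cycle3P[x [y [w [-> xy yw
    wx]]]] zS]|].
    have [[xyl ywl wxl]|[xyr ywr wxr]|[a [b [ra rb H]]]] := node_3cycle xy yw wx.
    - have /cyclesl[_ /negP] : [set x; y; w] \in cycles3 Nl; last by [].
      by rewrite inE; apply/cycle3P; exists x, y, w.
    - have /cyclesr[_ /negP] : [set x; y; w] \in cycles3 Nr; last by [].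
      by rewrite inE; apply/cycle3P; exists x, y, w.
    have -> : both by apply/bothP; exists a, b.
    rewrite inE ra rb /=; apply/eqP/setP => t; rewrite !inE.
    by case: H => -[-> -> ->]; case: (t == z); case: (t == a); case: (t == b).
  case: ifP; rewrite ?inE // => /bothP[a [b [ra rb]]]; rewrite ra rb /= => /eqP->.
  have [za ab bz] := top_cycle ra rb; split; last by rewrite !inE eqxx.
  by apply/cycle3P; exists z, a, b.
have split3 : cycles3 N = top :|: (cycles3 Nl :|: cycles3 Nr).
  apply/setP => S; rewrite !inE; apply/idP/idP; last first.
    by case/or3P => [/andP[]|/(sub Nl)|/(sub Nr)] // H; apply: H; [left|right].
  move=> cS; case: (boolP (z \in S)) => zS; first by rewrite cS.
  move: zS; case/cycle3P: (cS) => x [y [w [-> xy yw wx]]] zS.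
  have [[xyl ywl wxl]|[xyr ywr wxr]|[a [b [ra rb H]]]] := node_3cycle xy yw wx.
  - by apply/orP; right; apply/orP; left; apply/cycle3P; exists x, y, w.
  - by apply/orP; right; apply/orP; right; apply/cycle3P; exists x, y, w.
  by case: H zS => -[-> -> ->]; rewrite !inE eqxx ?orbT.
have ctop : #|top| = both by rewrite topE; case: both; rewrite ?cards1 ?cards0.
rewrite split3 cardsU ctop cardsU.
have -> : cycles3 Nl :&: cycles3 Nr = set0.
  apply/setP => S; rewrite in_setI in_set0; apply/negP.
  move=> /andP[/cyclesl[[x xS] _ /(_ x xS) xl] /cyclesr[_ _ /(_ x xS) xr]].
  by have := uT' x; lia.
have -> : top :&: (cycles3 Nl :|: cycles3 Nr) = set0.
  apply/setP => S; rewrite in_setI in_set0 in_setU; apply/negP.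
  rewrite inE => /andP[/andP[_ zS]] /orP[/cyclesl[_ /negP]|/cyclesr[_ /negP]]; exact.
by rewrite !cards0 !subn0.
Qed.

End Node.

(** No corners cancel in a tree, so arrows can be counted as corners. *)
Lemma tree_no_2cycle (T : tree V) : (forall x, mult x (nodes T) <= 1) ->
  forall x y, 0 < ncorners (tree_tris T) x y -> ncorners (tree_tris T) y x = 0.
Proof.
elim: T => [|z l IHl r IHr] uT; first by move=> x y; rewrite !ncorners_nil.
apply: node_no_2cycle => //; [apply: IHl|apply: IHr] => x; have := uT x;
by rewrite !multsE; lia.
Qed.

(** The top triangle contributes 2 (one 3-cycle), 1 (one loose arrow) or 0 according to its number
    of non-empty children, which makes up for the root terms of the children. *)
Lemma tree_count (T : tree V) : (forall x, mult x (nodes T) <= 1) ->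
  loose_arrows (ncorners (tree_tris T)) + 2 * #|cycles3 (ncorners (tree_tris T))|
  + (tree_root T != None) = size (nodes T).
Proof.
elim: T => [|z l IHl r IHr] uT.
  rewrite /loose_arrows big1 ?add0n => [|x _]; last first.
    by apply: big1 => y _; rewrite /= ncorners_nil muln0.
  rewrite addn0; apply/eqP; rewrite muln_eq0 /= cards_eq0; apply/eqP/setP => S.
  by rewrite !inE; apply/cycle3P => -[x [y [w [_ + _ _]]]]; rewrite ncorners_nil.
have ul x : mult x (nodes l) <= 1 by have := uT x; rewrite !multsE; lia.
have ur x : mult x (nodes r) <= 1 by have := uT x; rewrite !multsE; lia.
rewrite node_loose_arrows // node_cycles3 //= size_cat -(IHl ul) -(IHr ur).
by case: eqP; case: eqP => _ _; rewrite /=; lia.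
Qed.

End ThreeCycles.

(** * From drawings to annuli *)

Definition spans (V : finType) (Q : quiver V) (P : {set V}) (T : tree V) : Prop :=
  (forall x, mult x (nodes T) = (x \in P)) /\
  {in P &, forall x y,
    Q x y = ncorners (tree_tris T) x y - ncorners (tree_tris T) y x}.

Lemma full_subquiver_spans k (V : finType) (Q : quiver V) (P : {set V}) z :
    z \in P -> type_A k (full_subquiver Q P) -> valency_in Q P z <= 2 ->
    (valency_in Q P z = 2 -> exists2 S : {set V},
      oriented_3cycle Q S & (z \in S) && (S \subset P)) ->
  exists T, tree_root T = Some z /\ spans Q P T.
Proof.
move=> zP /type_A_polygon[L [R pLR]]; rewrite /valency_in big_sub => valz cyc.
pose zz : {x | x \in P} := exist _ z zP.
have [//||T [rT mT repT]] := @polygon_rooted _ _ _ _ zz pLR.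
  move=> /cyc[S /cycle3P[x [y [w [-> xy yw wx]]]] /andP[zS /subsetP SP]].
  have [xP yP wP] : [/\ x \in P, y \in P & w \in P].
    by split; apply: SP; rewrite !inE eqxx ?orbT.
  pose u : {x | x \in P} := exist _ x xP; pose v : {x | x \in P} := exist _ y yP.
  pose t : {x | x \in P} := exist _ w wP.
  move: zS; rewrite !inE => /orP[/orP[]|] /eqP ez.
  - by exists v, t; rewrite /= ez.
  - by exists t, u; rewrite /= ez.
  - by exists u, v; rewrite /= ez.
pose f (x : {x | x \in P}) : V := val x; have fI : injective f := val_inj.
exists (tree_map f T); split; first by rewrite tree_root_map rT.
split=> [x|x y xP yP].
  rewrite nodes_map; have [xP|xNP] := boolP (x \in P).
    by rewrite -[x]/(f (exist _ x xP)) mult_map.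
  have : x \notin map f (nodes T).
    by apply/mapP => -[[y yP] _ /= ex]; rewrite ex yP in xNP.
  by rewrite mem_mult; case: mult.
rewrite tree_tris_map -[x]/(f (exist _ x xP)) -[y]/(f (exist _ y yP)).
by rewrite !ncorners_map // -repT.
Qed.

(** [arrow_in_3cycle] seeks its third vertex in the whole quiver, the tree only in [P]; the closure
    hypothesis reconciles them. *)
Lemma spans_count (V : finType) (Q : quiver V) (P : {set V}) (T : tree V) :
    spans Q P T ->
    (forall x y w, x \in P -> y \in P ->
      0 < Q x y -> 0 < Q y w -> 0 < Q w x -> w \in P) ->
  \sum_(x in P) \sum_(y in P | ~~ arrow_in_3cycle Q x y) Q x y
  + 2 * #|[set S : {set V} | (S \subset P) && oriented_3cycle Q S]|
  + (tree_root T != None) = #|P|.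
Proof.
move=> [mT QT] closed.
have uT x : mult x (nodes T) <= 1 by rewrite mT; case: (_ \in _).
have szT : size (nodes T) = #|P|.
  rewrite cardE; apply: perm_size; apply: uniq_perm; rewrite ?enum_uniq //.
    exact/uniq_mult.
  by move=> x; rewrite mem_enum mem_mult mT; case: (_ \in _).
rewrite -szT -(tree_count uT); set N := ncorners (tree_tris T).
have QN : {in P &, forall x y, Q x y = N x y}.
  move=> x y xP yP; rewrite QT //; have := @tree_no_2cycle _ _ uT x y.
  by rewrite -/N; case: (N x y) => // n /(_ isT)->.
have N0 x y : 0 < N x y -> x \in P /\ y \in P.
  move=> Nxy; have H t : mult t (nodes T) = (t \in P) := mT t.
  by split; apply/negPn/negP => tP; move: Nxy; rewrite /N ncorners0 //;
    apply/orP; [left|right]; apply: tree_labels0; rewrite mT (negPf tP).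
have eqc : [set S : {set V} | (S \subset P) && oriented_3cycle Q S] = cycles3 N.
  apply/setP => S; rewrite !inE; apply/andP/cycle3P.
    move=> [/subsetP SP /cycle3P[x [y [w [eS xy yw wx]]]]]; exists x, y, w.
    have [xP yP wP] : [/\ x \in P, y \in P & w \in P].
      by split; apply: SP; rewrite eS !inE eqxx ?orbT.
    by rewrite -!QN.
  move=> [x [y [w [-> xy yw wx]]]].
  have [[xP yP] [_ wP]] := (N0 _ _ xy, N0 _ _ yw); split.
    by apply/subsetP => t; rewrite !inE => /orP[/orP[]|] /eqP->.
  by apply/cycle3P; exists x, y, w; rewrite !QN.
rewrite eqc; congr (_ + _ + _); rewrite /loose_arrows big_mkcond /=.
apply: eq_bigr => x _; case: ifP => xP; last first.
  apply/esym/big1 => y _; have [->|/N0[]] := posnP (N x y); first by rewrite muln0.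
  by rewrite xP.
rewrite big_mkcond; apply: eq_bigr => y _; case yP: (y \in P) => /=; last first.
  by have [->|/N0[_]] := posnP (N x y); rewrite ?muln0 ?yP.
rewrite QN //; have [->|Nxy] := posnP (N x y); first by rewrite muln0 if_same.
suff -> : arrow_in_3cycle Q x y = in_3cycle N x y by case: in_3cycle; rewrite ?mul1n.
apply: eq_existsb => w; apply/andP/andP => -[yw wx].
  have wP : w \in P by apply: (closed x y); rewrite // QN.
  by rewrite -!QN.
have [_ wP] := N0 _ _ yw.
by rewrite !QN.
Qed.

Section Cyclic.
Variable V : finType.
Implicit Types (c : nat -> V) (o : nat -> bool) (T : nat -> tree V).

Definition steps_of c o T (a n : nat) : seq (step V) :=
  [seq (o i, T i, c i.+1) | i <- iota a n].

Lemma steps_tris_of c o T a n x y :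
  ncorners (steps_tris (c a) (steps_of c o T a n)) x y =
  \sum_(a <= i < a + n) (ncorner (step_tri (c i) (o i, T i, c i.+1)) x y
                         + ncorners (tree_tris (T i)) x y).
Proof.
elim: n a => [|n IH] a; first by rewrite addn0 big_geq // ncorners_nil.
rewrite big_ltn ?addnS ?ltnS ?leq_addr // -addSn -IH.
by rewrite /= ncorners_cons ncorners_cat addnA.
Qed.

Lemma steps_nodes_of c o T a n x :
  mult x (steps_nodes (steps_of c o T a n)) =
  \sum_(a <= i < a + n) ((c i.+1 == x) + mult x (nodes (T i))).
Proof.
elim: n a => [|n IH] a; first by rewrite addn0 big_geq.
rewrite big_ltn ?addnS ?ltnS ?leq_addr // -addSn -IH.
by rewrite /= !multsE addnA.
Qed.

Lemma steps_end_of c o T a n : steps_end (c a) (steps_of c o T a n) = c (a + n).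
Proof. by elim: n a => [|n IH] a; rewrite ?addn0 // addnS -addSn -IH. Qed.

End Cyclic.

Lemma ordS_inj n : injective (@ordS n).
Proof.
case: n => [|n] i j; first by case: i.
move=> /(congr1 val) /= e; apply/val_inj => /=; move: e.
have := ltn_ord i; have := ltn_ord j => jn in_.
have [i1|i1] := ltnP i.+1 n.+1; have [j1|j1] := ltnP j.+1 n.+1.
- by rewrite !modn_small // => -[].
- have -> : j.+1 = n.+1 by lia.
  by rewrite modnn modn_small.
- have -> : i.+1 = n.+1 by lia.
  by rewrite modnn modn_small.
- by lia.
Qed.

Lemma drawing_trees (V : finType) (Q : quiver V) (D : drawing V) :
    remainder_decomposition Q D ->
  exists T : 'I_(dlen D) -> tree V, forall e,
    tree_root (T e) = datt e /\ spans Q (dpart e) (T e).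
Proof.
move=> [_ _ _ none some]; apply: (@fin_all_exists _ (fun=> tree V)
  (fun e T => tree_root T = datt e /\ spans Q (dpart e) T)) => e.
case ez: (datt e) => [z|].
  have [zP [k _ tA] v2 v3] := some _ _ ez.
  exact: full_subquiver_spans zP tA v2 v3.
exists Leaf; split=> //; split=> [x|x y]; rewrite (none _ ez) ?inE //.
Qed.

(** Distinct parts are not joined. If [w] were on the cycle, [y -> w] and [w -> x] would make both
    [y] and [x] the vertex attached to [e], and [x -> y] would be a loop. *)
Lemma part_closed (V : finType) (Q : quiver V) (D : drawing V) (e : 'I_(dlen D)) x y w :
    drawing_of Q D ->
    x \in dpart e -> y \in dpart e ->
  0 < Q x y -> 0 < Q y w -> 0 < Q w x -> w \in dpart e.
Proof.
move=> [_ [att1 att2 att3] [cov dis sep none some]] xe ye xy yw wx.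
have off (f : 'I_(dlen D)) t : t \in dpart f -> t \notin on_cycle D.
  by move=> tf; rewrite -in_setC cov; apply/bigcupP; exists f.
have uniq_part (f g : 'I_(dlen D)) t : t \in dpart f -> t \in dpart g -> f = g.
  move=> tf tg; apply/eqP; apply: contraTT isT => /dis /pred0P /(_ t) /=.
  by rewrite tf tg.
have [/imsetP[a _ ew]|] := boolP (w \in on_cycle D); last first.
  rewrite -in_setC cov => /bigcupP[f _ wf].
  have [-> //|ef] := eqVneq e f.
  by rewrite (sep _ _ _ _ ef ye wf) in yw.
rewrite ew in yw wx.
have [f fy _] := att3 _ _ (off _ _ ye) yw; have [g gx _] := att2 _ _ (off _ _ xe) wx.
have [yf _ _ _] := some _ _ fy; have [xg _ _ _] := some _ _ gx.
rewrite (uniq_part _ _ _ yf ye) in fy; rewrite (uniq_part _ _ _ xg xe) in gx.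
by move: fy xy; rewrite gx => -[->]; rewrite arr_loop.
Qed.

(** A cycle arrow without attached vertex counts 1 and has an empty part. With one, its 3-cycle
    counts 2: one for the successor, one for the [+ 1] in [k = a + 2 c + 1]. *)
Lemma param_sum (V : finType) (Q : quiver V) (D : drawing V) b : drawing_of Q D ->
  param1 Q D b + 2 * param2 Q D b = \sum_(e < dlen D | dcw e == b) #|dpart e|.+1.
Proof.
move=> dD; have [_ _ rD] := dD; have [T HT] := drawing_trees rD.
rewrite /param1 /param2.
have cardE (p : pred 'I_(dlen D)) :
    #|[set e : 'I_(dlen D) | (dcw e == b) && p e]| = \sum_(e < dlen D | dcw e == b) p e.
  rewrite -sum1_card big_mkcond [RHS]big_mkcond; apply: eq_bigr => e _.
  by rewrite inE; case: (_ == b) => //; case: (p e).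
rewrite !cardE mulnDr !big_distrr /= -!big_split /=; apply: eq_bigr => e _.
have [rT sT] := HT e.
rewrite -(spans_count sT); last by move=> x y w; apply: part_closed.
by rewrite rT; case: eqP => _; rewrite /=; lia.
Qed.

(** Edge [e] becomes the step whose triangle has the sides tail, head and [datt e]. Arrows on the
    cycle, between the cycle and a part, and among parts are matched separately. *)
Lemma drawing_annulus (V : finType) (Q : quiver V) (D : drawing V) :
    drawing_of Q D ->
  exists x s, annulus Q x s /\
    forall b, weight b s = param1 Q D b + 2 * param2 Q D b.
Proof.
move=> dD; have [cD aD rD] := dD; have [T HT] := drawing_trees rD.
suff [x [s [an w]]] : exists x s, annulus Q x s /\
    forall b, weight b s = \sum_(e < dlen D | dcw e == b) #|dpart e|.+1.
  by exists x, s; split=> // b; rewrite w param_sum.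
have [_ dis sep none some] := rD; have [cov _ _ _ _] := rD.
have [att1 att2 att3] := aD; have [m2 cI [e1 oe1] [e0 oe0] cQ] := cD.
have off (e : 'I_(dlen D)) t : t \in dpart e -> t \notin on_cycle D.
  by move=> te; rewrite -in_setC cov; apply/bigcupP; exists e.
have uniq_part (e f : 'I_(dlen D)) t : t \in dpart e -> t \in dpart f -> e = f.
  move=> te tf; apply/eqP; apply: contraTT isT => /dis /pred0P /(_ t) /=.
  by rewrite te tf.
have on (a : 'I_(dlen D)) : dcyc a \in on_cycle D by apply/imsetP; exists a.
have cyc_part (a e : 'I_(dlen D)) : (dcyc a \in dpart e) = false.
  by apply/negP => /off /negP; apply; apply: on.
have att_part (e : 'I_(dlen D)) t : datt e = Some t -> t \in dpart e by move=> /some[].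
have part_ex t : t \notin on_cycle D -> exists e : 'I_(dlen D), t \in dpart e.
  by rewrite -in_setC cov => /bigcupP[e _ te]; exists e.
clear dD rD cD aD.
case: D T HT m2 cI e1 oe1 e0 oe0 cQ att1 att2 att3 dis sep none some cov off
  uniq_part on cyc_part att_part part_ex
  => m /= c o att part T HT m2 cI e1 oe1 e0 oe0 cQ att1 att2 att3 dis sep none some
    cov off uniq_part on cyc_part att_part part_ex.
case: m c o att part T HT m2 cI e1 oe1 e0 oe0 cQ att1 att2 att3 dis sep none some
  cov off uniq_part on cyc_part att_part part_ex => // m c o att part T HT m2 cI e1
  oe1 e0 oe0 cQ att1 att2 att3 dis sep none some cov off uniq_part on cyc_part
  att_part part_ex.
(* Only [c'] is evaluated at [m.+1], the end of the last step; the modulus closes the cycle. *)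
pose c' i := c (inord (i %% m.+1)); pose o' i := o (inord i); pose T' i := T (inord i).
pose s := steps_of c' o' T' 0 m.+1.
have cE (e : 'I_m.+1) : c' e = c e by rewrite /c' modn_small // inord_val.
have cSE (e : 'I_m.+1) : c' e.+1 = c (ordS e).
  by rewrite /c'; congr c; apply: val_inj; rewrite /= inordK ?ltn_pmod.
have NE x y : ncorners (steps_tris (c' 0) s) x y = \sum_(e < m.+1)
    (ncorner (Some (c (etail o e)), Some (c (ehead o e)), att e) x y
     + ncorners (tree_tris (T e)) x y).
  rewrite steps_tris_of big_mkord; apply: eq_bigr => e _.
  rewrite cE cSE /o' /T' inord_val /step_tri /etail /ehead /= (proj1 (HT e)).
  by case: ifP.
have attc e a : (att e == Some (c a)) = false.
  by apply/eqP => /att_part; rewrite cyc_part.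
have tree0 e x y : (x \notin part e) || (y \notin part e) ->
    ncorners (tree_tris (T e)) x y = 0.
  move=> H; apply: ncorners0; case/orP: H => H; apply/orP; [left|right];
  by apply: tree_labels0; rewrite (proj1 (proj2 (HT e))) (negPf H).
have Scc x y : (Some x == Some y :> option V) = (x == y) by rewrite (inj_eq
  (@Some_inj _)).
have Ncc a b : ncorners (steps_tris (c' 0) s) (c a) (c b) = Q (c a) (c b).
  rewrite NE cQ; apply: eq_bigr => e _; rewrite tree0 ?cyc_part // addn0.
  by rewrite /ncorner /= !attc !Scc !(inj_eq cI) !muln0 !mul0n !addn0 mulnb.
have cycN y a : y \notin [set c a | a : 'I_m.+1] -> (c a == y) = false.
  by move=> yN; apply/eqP => e; move: yN; rewrite -e on.
have Nce a y : y \notin [set c a | a : 'I_m.+1] ->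
    ncorners (steps_tris (c' 0) s) (c a) y = \sum_(e < m.+1) (ehead o e == a) * (att
      e == Some y).
  move=> yN; rewrite NE; apply: eq_bigr => e _; rewrite tree0 ?cyc_part // addn0.
  by rewrite /ncorner /= !attc !Scc !(inj_eq cI) !(cycN y) // !muln0 !addn0.
have Nec a y : y \notin [set c a | a : 'I_m.+1] ->
    ncorners (steps_tris (c' 0) s) y (c a) = \sum_(e < m.+1) (att e == Some y) *
      (etail o e == a).
  move=> yN; rewrite NE; apply: eq_bigr => e _; rewrite tree0 ?cyc_part ?orbT // addn0.
  by rewrite /ncorner /= !attc !Scc !(inj_eq cI) !(cycN y) // !muln0 !mul0n !add0n.
have Qce a y : y \notin [set c a | a : 'I_m.+1] -> Q (c a) y =
    \sum_(e < m.+1) (ehead o e == a) * (att e == Some y).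
  move=> yN; have [q0|/(att2 _ _ yN)[e ey ea]] := posnP (Q (c a) y).
    rewrite q0 big1 // => e _; case: eqP => // ea; case: eqP => // ey.
    by have [_] := att1 _ _ ey; rewrite ea q0.
  rewrite (bigD1 e) //= ea ey !eqxx big1 ?addn0 => [|f fe].
    by have [_] := att1 _ _ ey; rewrite ea.
  case: (att f =P Some y) => [fy|]; last by rewrite muln0.
  by case/eqP: fe; apply: uniq_part (att_part _ _ fy) (att_part _ _ ey).
have Qec a y : y \notin [set c a | a : 'I_m.+1] -> Q y (c a) =
    \sum_(e < m.+1) (att e == Some y) * (etail o e == a).
  move=> yN; have [q0|/(att3 _ _ yN)[e ey ea]] := posnP (Q y (c a)).
    rewrite q0 big1 // => e _; case: eqP => // ey; case: eqP => // ea.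
    by have [_ _] := att1 _ _ ey; rewrite ea q0.
  rewrite (bigD1 e) //= ea ey !eqxx big1 ?addn0 => [|f fe].
    by have [_ _] := att1 _ _ ey; rewrite ea.
  case: (att f =P Some y) => [fy|]; last by rewrite mul0n.
  by case/eqP: fe; apply: uniq_part (att_part _ _ fy) (att_part _ _ ey).
(* Without 2-cycles, [Q] is its own signed count. *)
have sub2 x y : Q x y = Q x y - Q y x.
  by have := @arr_2cycle _ Q x y; case: (Q x y) => // k ->.
exists (c' 0), s; split; [split|].
- move=> x y.
  have [/imsetP[a _ ->]|xN] := boolP (x \in [set c a | a : 'I_m.+1]);
  have [/imsetP[b _ ->]|yN] := boolP (y \in [set c a | a : 'I_m.+1]).
  + by rewrite !Ncc.
  + by rewrite Nce // Nec // -Qce // -Qec.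
  + by rewrite Nce // Nec // -Qce // -Qec.
  have [e xe] := part_ex _ xN; have [f yf] := part_ex _ yN.
  have NT u v : u \notin [set c a | a : 'I_m.+1] -> v \notin [set c a | a : 'I_m.+1] ->
      ncorners (steps_tris (c' 0) s) u v = \sum_(e < m.+1) ncorners (tree_tris (T e)) u v.
    move=> uN vN; rewrite NE; apply: eq_bigr => g _.
    by rewrite /ncorner /= !Scc !cycN // !muln0 !mul0n.
  have [ef|ef] := eqVneq e f.
    subst f; rewrite !NT // (bigD1 e) //= big1 ?addn0 => [|g ge].
      rewrite (bigD1 e) //= [X in _ = _ - (_ + X)]big1 ?addn0 => [|g ge].
        by rewrite (proj2 (proj2 (HT e))).
      by apply: tree0; apply/orP; left; apply/negP => /uniq_part/(_ yf)/eqP; apply/negP.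
    by apply: tree0; apply/orP; left; apply/negP => /uniq_part/(_ xe)/eqP; apply/negP.
  rewrite (sep _ _ _ _ ef xe yf) !NT // big1 // => g _.
  apply: tree0; rewrite -negb_and; apply: contra ef => /andP[xg yg].
  by rewrite (uniq_part _ _ _ xe xg) (uniq_part _ _ _ yf yg).
- move=> x; rewrite steps_nodes_of big_mkord.
  rewrite (eq_bigr (fun e : 'I_m.+1 => (c (ordS e) == x) + (x \in part e))); last first.
    by move=> e _; rewrite cSE /T' inord_val (proj1 (proj2 (HT e))).
  rewrite big_split /=; have [/imsetP[a _ ->]|xN] := boolP (x \in [set c a | a :
    'I_m.+1]).
    rewrite [X in _ + X]big1 ?addn0 => [|e _]; last by rewrite cyc_part.
    (* Each vertex of the cycle is the end of exactly one step, the one given by the inverse of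
       [ordS]. *)
    have [g _ gK] := injF_bij (@ordS_inj m.+1).
    rewrite (bigD1 (g a)) //= gK eqxx big1 // => e ne.
    apply/eqP; rewrite eqb0 (inj_eq cI); apply: contra ne => /eqP <-.
    by apply/eqP/(@ordS_inj m.+1); rewrite gK.
  rewrite big1 ?add0n => [|e _]; last by rewrite cycN.
  have [e xe] := part_ex _ xN.
  rewrite (bigD1 e) //= xe big1 // => f fe.
  by apply/eqP; rewrite eqb0; apply: contra fe => xf; apply/eqP/(uniq_part _ _ _ xf xe).
- by rewrite steps_end_of /c' add0n modnn mod0n.
- rewrite has_map; apply/hasP; exists (val e1); first by rewrite mem_iota /=.
  by rewrite /= /o' inord_val.
- rewrite has_map; apply/hasP; exists (val e0); first by rewrite mem_iota /=.
  by rewrite /= /o' inord_val.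
move=> b; rewrite /weight big_map -[iota 0 m.+1]/(index_iota 0 m.+1) big_mkord.
apply: eq_big => e; rewrite /= /o' inord_val // => _; congr _.+1.
rewrite /T' inord_val; have [_ [mT _]] := HT e.
rewrite cardE; apply: perm_size; apply: mult_perm_eq => x; rewrite mT.
by rewrite [RHS](count_uniq_mem _ (enum_uniq _)) mem_enum.
Qed.

Theorem theorem3p12 (n : nat) (hn : 1 <= n) (V1 V2 : finType)
    (Q1 : quiver V1) (Q2 : quiver V2)
    (hQ1 : class_Q n Q1) (hQ2 : class_Q n Q2)
    (r1 r2 s1 s2 r1' r2' s1' s2' : nat)
    (hp1 : has_parameters Q1 r1 r2 s1 s2)
    (hp2 : has_parameters Q2 r1' r2' s1' s2') :
  mutation_equivalent Q1 Q2 <->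
    (r1 + 2 * r2 = r1' + 2 * r2' /\ s1 + 2 * s2 = s1' + 2 * s2') \/
    (r1 + 2 * r2 = s1' + 2 * s2' /\ s1 + 2 * s2 = r1' + 2 * r2').
Proof.
have [D1 dD1 [-> -> -> ->]] := hp1; have [D2 dD2 [-> -> -> ->]] := hp2.
have [x [s [an w]]] := drawing_annulus dD1.
have [y [t [an' w']]] := drawing_annulus dD2.
rewrite -!w -!w'; split=> [[ks [f bf ef]]|[[e0 e1]|[e0 e1]]].
(* The annulus of [Q1], mutated along [ks] and relabelled by [f], becomes a second annulus of
   [Q2]. *)
- have [x' [s' [/(annulus_iso (bij_inj bf) bf ef) ans' ws']]] :=
    annulus_foldl_mutation ks an.
  have := annulus_weight_unique ans' an'.
  by rewrite !weight_map ?ws'; intuition.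
- by apply: annulus_equivalent an an' _; case.
- apply: annulus_equivalent an (annulus_rev an') _.
  by case; rewrite weight_steps_rev.
Qed.
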